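(* Let $N_1$ and $N_2$ be positive odd integers and let $x\in\mathbb{C}$ with $\mathrm{Re}(x)>0$. Then $$\sqrt{N_2}\prod_{m_1=0}^{N_1-1}\bar\Gamma_1\left(N_2x+\frac{N_2}{N_1}m_1\right)^{(-1)^{m_1}}=\sqrt{N_1}\prod_{m_2=0}^{N_2-1}\bar\Gamma_1\left(N_1x+\frac{N_1}{N_2}m_2\right)^{(-1)^{m_2}}.$$
   Context: For $\mathrm{Re}(x)>0$, the alternating Hurwitz zeta function is $\zeta_E(s,x)=\sum_{m=0}^\infty(-1)^m(m+x)^{-s}$ for $\mathrm{Re}(s)>0$ (principal branch), continued analytically to an entire function of $s$, and $\bar\Gamma_1(x)=\exp\left(\frac{\partial}{\partial s}\zeta_E(s,x)\big|_{s=0}\right)$. *)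

(* Defs.v *)
From Stdlib Require Import Reals ZArith ClassicalEpsilon.
From Coquelicot Require Import Coquelicot.
Open Scope R_scope.

Definition Cexp (z : C) : C :=
  (exp (Re z) * cos (Im z), exp (Re z) * sin (Im z)).

(* Principal argument, with values in (-PI, PI]; [Carg 0 = 0] is a convention. *)
Definition Carg (z : C) : R :=
  if Rlt_dec 0 (Re z) then atan (Im z / Re z)
  else if Rlt_dec 0 (Im z) then PI / 2 - atan (Re z / Im z)
  else if Rlt_dec (Im z) 0 then - (PI / 2) - atan (Re z / Im z)
  else if Rlt_dec (Re z) 0 then PI
  else 0.

Definition Clog (z : C) : C := (ln (Cmod z), Carg z).

Definition Cpower (z w : C) : C := Cexp (w * Clog z)%C.

Definition CpowZ (z : C) (k : Z) : C :=
  match k with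
  | Z0 => 1
  | Zpos p => (z ^ Pos.to_nat p)%C
  | Zneg p => (/ z ^ Pos.to_nat p)%C
  end.

Fixpoint Cprod (f : nat -> C) (n : nat) : C :=
  match n with
  | O => 1
  | S k => (Cprod f k * f k)%C
  end.

Definition zetaE_term (s x : C) (m : nat) : C :=
  ((- (1)) ^ m * Cpower (RtoC (INR m) + x) (- s))%C.

Definition entire (f : C -> C) : Prop :=
  forall s : C, @ex_derive C_AbsRing C_NormedModule f s.

(* [Z] is the continuation of the series to an entire function of [s].  The
   series is only conditionally convergent when [0 < Re s <= 1]; [is_series]
   is convergence of the partial sums in the natural order. *)
Definition zetaE_continuation (x : C) (Z : C -> C) : Prop :=
  entire Z /\
  forall s : C, 0 < Re s ->
    @is_series C_AbsRing C_NormedModule (zetaE_term s x) (Z s).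

(* For [0 < Re x] exactly one function satisfies [zetaE_continuation x];
   [epsilon] selects it.  For other [x] the value is junk. *)
Definition zetaE (s x : C) : C :=
  epsilon (inhabits (fun _ : C => RtoC 0)) (zetaE_continuation x) s.

Definition Gamma1_bar (x : C) : C :=
  Cexp (C_derive (fun s : C => zetaE s x) 0).

(* Main.v *)
Require Import Defs.
From Stdlib Require Import Reals ZArith ClassicalEpsilon FunctionalExtensionality Lra Lia.
From Coquelicot Require Import Coquelicot.
Open Scope R_scope.

(** Put [S_(M,N)(s)] for the sum of [(-1)^m zeta_E(s, N x + (N/M) m)] over
    [m < M]. For [Re s > 0] each term of the series in it is
    [(k + N x + (N/M) m)^(-s) = M^s (M k + N m + M N x)^(-s)], with sign
    [(-1)^(k+m)]. Cut the range of [k] into blocks of length [N], [k = N q + r]: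
    since [N] is odd the sign is [(-1)^(q+r+m)], and the base is
    [M N q + (M r + N m) + M N x]. With [r < N] and [m < M], exchanging [M] with [N]
    only exchanges the names of [r] and [m] ([lattice_sum_sym]). Hence
    [M^(-s) S_(M,N)(s) = N^(-s) S_(N,M)(s)] ([zeta_node_sum_sym]).

    Both sides are differentiable at [0], and a derivative at [0] is already
    determined by the values at positive reals ([derive_eq_right]). So the identity
    may be differentiated at [0] without appeal to uniqueness of analytic
    continuation. As [zeta_E(0, y) = 1/2] ([zetaE_0]) and there is an odd number of
    alternating signs, [S_(M,N)(0) = 1/2], and differentiation gives
    [S_(M,N)'(0) - (ln M)/2 = S_(N,M)'(0) - (ln N)/2] ([log_gamma_sum_sym]).
    The theorem is the exponential of this equation; the square roots are the
    contribution of [zeta_E(0, y)].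

    Since [zetaE] is chosen by [epsilon], an entire continuation has to be exhibited.
    It is produced by Euler's transformation: writing [D b] for the differences
    [b m - b (m+1)], the alternating sum of [b] is half of [b 0] plus half of the
    alternating sum of [D b]. After [N] steps the series to be summed is that of the
    [N]-th differences of [(m + x)^(-s)], which are bounded by the [N]-th derivative
    and so are of order [m^(-Re s - N)]; this converges absolutely once [N] exceeds
    [|s|] sufficiently, and the value does not depend on [N] ([zeta_euler_eq]).
    Holomorphy in [s] is obtained without uniform limits of holomorphic functions: the
    transformation is linear, so it may be applied to the second order remainder
    [b_(s+h) - b_s - h b_s'] itself, whose [N]-th differences are [O(|h|^2)] times a
    summable sequence ([pow_deriv_rem_fdiffn], [zeta_euler_entire]). *)

(** * Complex exponential and logarithm *)

Lemma C_eq (z w : C) : Re z = Re w -> Im z = Im w -> z = w.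
Proof. destruct z, w; simpl; intros; subst; reflexivity. Qed.

Lemma Cexp_plus (a b : C) : Cexp (a + b) = (Cexp a * Cexp b)%C.
Proof.
  destruct a as [a1 a2], b as [b1 b2].
  apply C_eq; unfold Cexp; simpl; rewrite exp_plus, ?cos_plus, ?sin_plus; ring.
Qed.

Lemma Cexp_0 : Cexp 0 = 1%C.
Proof. apply C_eq; unfold Cexp; simpl; rewrite exp_0, ?cos_0, ?sin_0; ring. Qed.

Lemma Cexp_RtoC (r : R) : Cexp (RtoC r) = RtoC (exp r).
Proof. apply C_eq; unfold Cexp; simpl; rewrite ?cos_0, ?sin_0; ring. Qed.

Lemma Cmod_Cexp (z : C) : Cmod (Cexp z) = exp (Re z).
Proof.
  unfold Cmod, Cexp; simpl.
  replace (_ + _) with ((exp (Re z))²).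
  - apply sqrt_Rsqr, Rlt_le, exp_pos.
  - generalize (sin2_cos2 (Im z)); unfold Rsqr; simpl; intros H.
    transitivity (exp (Re z) * exp (Re z) * (sin (Im z) * sin (Im z) + cos (Im z) * cos (Im z))).
    + rewrite H; ring.
    + ring.
Qed.

Lemma Cexp_neq_0 (z : C) : Cexp z <> 0%C.
Proof.
  intros H. apply (f_equal Cmod) in H. rewrite Cmod_Cexp, Cmod_0 in H.
  generalize (exp_pos (Re z)); lra.
Qed.

Lemma Cexp_opp (z : C) : Cexp (- z) = (/ Cexp z)%C.
Proof.
  assert (H : (Cexp (- z) * Cexp z)%C = 1%C).
  { rewrite <- Cexp_plus, <- Cexp_0. f_equal. ring. }
  rewrite <- (Cmult_1_l (/ Cexp z)), <- H. field. apply Cexp_neq_0.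
Qed.

Lemma Carg_right (u : C) : 0 < Re u -> Carg u = atan (Im u / Re u).
Proof. intros H; unfold Carg; destruct (Rlt_dec 0 (Re u)); [reflexivity | lra]. Qed.

Lemma Cmod_right (u : C) :
  0 < Re u -> Cmod u = Re u * sqrt (1 + (Im u / Re u)²).
Proof.
  intros H. unfold Cmod.
  rewrite <- (sqrt_Rsqr (Re u)) at 1 by lra.
  rewrite <- sqrt_mult_alt by apply Rle_0_sqr.
  f_equal. unfold Rsqr; destruct u as [a b]; simpl in *. field. lra.
Qed.

Lemma Re_neq_0 (u : C) : 0 < Re u -> u <> 0%C.
Proof. intros H E. rewrite E in H. simpl in H. lra. Qed.

Lemma Cexp_Clog (u : C) : 0 < Re u -> Cexp (Clog u) = u.
Proof.
  intros H.
  assert (Hm : 0 < Cmod u) by (apply Cmod_gt_0, Re_neq_0, H).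
  set (q := sqrt (1 + (Im u / Re u)²)).
  assert (Hq : 0 < q) by (apply sqrt_lt_R0; generalize (Rle_0_sqr (Im u / Re u)); lra).
  unfold Cexp, Clog; simpl. rewrite exp_ln by exact Hm.
  rewrite Carg_right, cos_atan, sin_atan, Cmod_right by exact H. fold q.
  apply C_eq; simpl; field; lra.
Qed.

(** Positive scaling does not change the principal argument, so no multiple of
    [2 i PI] appears. *)
Lemma Clog_scal (r : R) (u : C) :
  0 < r -> 0 < Re u -> Clog (RtoC r * u) = (RtoC (ln r) + Clog u)%C.
Proof.
  intros Hr Hu.
  assert (Hm : 0 < Cmod u) by (apply Cmod_gt_0, Re_neq_0, Hu).
  assert (E : Re (RtoC r * u)%C = r * Re u) by (unfold Re, Im; simpl; ring).
  assert (E' : Im (RtoC r * u)%C = r * Im u) by (unfold Re, Im; simpl; ring).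
  apply C_eq; simpl.
  - rewrite Cmod_mult, Cmod_R, Rabs_pos_eq by lra. apply ln_mult; lra.
  - rewrite !Carg_right, E, E' by (try rewrite E; try apply Rmult_lt_0_compat; lra).
    rewrite Rplus_0_l. f_equal. field. lra.
Qed.

(** * Calculus of complex-valued functions of a real variable *)

Definition Cderiv (f : R -> C) (t : R) (l : C) : Prop :=
  is_derive (fun t => Re (f t)) t (Re l) /\ is_derive (fun t => Im (f t)) t (Im l).

Lemma Cderiv_eq f t l l' : Cderiv f t l -> l = l' -> Cderiv f t l'.
Proof. intros H E; subst; exact H. Qed.

Lemma Cderiv_const c t : Cderiv (fun _ => c) t 0.
Proof. split; simpl; auto_derive; reflexivity. Qed.

Lemma Cderiv_mult f g t a b :
  Cderiv f t a -> Cderiv g t b ->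
  Cderiv (fun t => (f t * g t)%C) t (a * g t + f t * b)%C.
Proof.
  intros [H1 H2] [H3 H4]; split; simpl.
  - evar_last.
    + apply @is_derive_minus; apply @is_derive_mult; try eassumption; intros; apply Rmult_comm.
    + unfold minus, plus, opp, mult; simpl. unfold Re, Im. ring.
  - evar_last.
    + apply @is_derive_plus; apply @is_derive_mult; try eassumption; intros; apply Rmult_comm.
    + unfold minus, plus, opp, mult; simpl. unfold Re, Im. ring.
Qed.

Lemma Cderiv_scal c f t a :
  Cderiv f t a -> Cderiv (fun t => (c * f t)%C) t (c * a)%C.
Proof.
  intros H. eapply Cderiv_eq.
  - apply Cderiv_mult; [apply Cderiv_const | exact H].
  - simpl. ring.
Qed.

Lemma Cderiv_minus f g t a b :
  Cderiv f t a -> Cderiv g t b -> Cderiv (fun t => (f t - g t)%C) t (a - b)%C.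
Proof.
  intros [H1 H2] [H3 H4]; split; simpl; apply @is_derive_minus; assumption.
Qed.

Lemma Cderiv_shift f t a :
  Cderiv f (t + 1) a -> Cderiv (fun t => f (t + 1)) t a.
Proof.
  intros [H1 H2]; split; simpl.
  - evar_last.
    + apply (is_derive_comp (fun t => Re (f t)) (fun t => t + 1)); [exact H1 | auto_derive; reflexivity].
    + unfold scal; simpl; unfold mult; simpl; ring.
  - evar_last.
    + apply (is_derive_comp (fun t => Im (f t)) (fun t => t + 1)); [exact H2 | auto_derive; reflexivity].
    + unfold scal; simpl; unfold mult; simpl; ring.
Qed.

Lemma Cderiv_exp f t a :
  Cderiv f t a -> Cderiv (fun t => Cexp (f t)) t (a * Cexp (f t))%C.
Proof.
  intros [H1 H2]; split; simpl.
  - evar_last.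
    + apply @is_derive_mult; [ | | intros; apply Rmult_comm].
      * apply (is_derive_comp exp (fun t => Re (f t))); [apply is_derive_exp | exact H1].
      * apply (is_derive_comp cos (fun t => Im (f t))); [apply is_derive_cos | exact H2].
    + unfold plus, mult, scal; simpl. unfold mult; simpl. unfold Re, Im. ring.
  - evar_last.
    + apply @is_derive_mult; [ | | intros; apply Rmult_comm].
      * apply (is_derive_comp exp (fun t => Re (f t))); [apply is_derive_exp | exact H1].
      * apply (is_derive_comp sin (fun t => Im (f t))); [apply is_derive_sin | exact H2].
    + unfold plus, mult, scal; simpl. unfold mult; simpl. unfold Re, Im. ring.
Qed.

(** Both parts are differentiated through formulas valid only in the right half-plane:
    [ln |z|] as half of [ln |z|^2], and the argument as an arctangent. *)
Lemma Cderiv_Clog (x : C) (t : R) :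
  0 < t + Re x -> Cderiv (fun t => Clog (RtoC t + x)) t (/ (RtoC t + x))%C.
Proof.
  intros Ht. destruct x as [p q]; simpl in Ht.
  assert (Hn : (t + p) * (t + p) + q * q <> 0) by nra.
  assert (Hloc : locally t (fun t => 0 < t + p)).
  { apply (open_gt 0 : open (fun y => 0 < y)) in Ht.
    assert (Hc : continuous (fun t => t + p) t).
    { apply (continuous_plus (fun t => t) (fun _ => p)); [apply continuous_id | apply continuous_const]. }
    exact (Hc _ Ht). }
  split; unfold Clog; simpl.
  - apply (is_derive_ext_loc (fun t => / 2 * ln ((t + p) * (t + p) + q * q))).
    + revert Hloc; apply filter_imp. intros s Hs. unfold Cmod; simpl.
      replace ((s + p) * ((s + p) * 1) + (0 + q) * ((0 + q) * 1))
        with ((s + p) * (s + p) + q * q) by ring.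
      rewrite <- Rpower_sqrt by nra. unfold Rpower. now rewrite ln_exp.
    + auto_derive; [nra | field; nra].
  - apply (is_derive_ext_loc (fun t => atan (q / (t + p)))).
    + revert Hloc; apply filter_imp. intros s Hs.
      rewrite Carg_right by (simpl; lra). simpl. now rewrite Rplus_0_l.
    + auto_derive; [lra | ]. field. repeat split; nra.
Qed.

Lemma Cmod_le_sum (z : C) : Cmod z <= Rabs (Re z) + Rabs (Im z).
Proof.
  replace z with (RtoC (Re z) + Ci * RtoC (Im z))%C
    at 1 by (apply C_eq; unfold Re, Im; simpl; ring).
  eapply Rle_trans; [apply Cmod_triangle | ].
  rewrite Cmod_mult, !Cmod_R.
  replace (Cmod Ci) with 1; [lra | ].
  unfold Cmod, Ci; simpl. replace (_ + _) with 1 by ring. now rewrite sqrt_1.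
Qed.

Lemma Im_le_Cmod (z : C) : Rabs (Im z) <= Cmod z.
Proof.
  eapply Rle_trans; [apply Rmax_r | apply Rmax_Cmod].
Qed.

(** The factor 2 comes from treating real and imaginary parts separately. *)
Lemma Cderiv_mean_value (f f' : R -> C) (a b B : R) :
  a <= b ->
  (forall t, a <= t <= b -> Cderiv f t (f' t)) ->
  (forall t, a <= t <= b -> Cmod (f' t) <= B) ->
  Cmod (f b - f a) <= 2 * B * (b - a).
Proof.
  intros Hab Hd HB.
  assert (Hr : Rabs (Re (f b) - Re (f a)) <= B * (b - a)).
  { destruct (MVT_gen (fun t => Re (f t)) a b (fun t => Re (f' t))) as [c [Hc E]].
    - rewrite Rmin_left, Rmax_right by exact Hab. intros t Ht. apply Hd; lra.
    - rewrite Rmin_left, Rmax_right by exact Hab. intros t Ht.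
      apply continuity_pt_filterlim, (@ex_derive_continuous R_AbsRing R_NormedModule).
      exists (Re (f' t)); exact (proj1 (Hd t Ht)).
    - rewrite Rmin_left, Rmax_right in Hc by exact Hab. rewrite E, Rabs_mult, (Rabs_pos_eq (b - a)) by lra.
      apply Rmult_le_compat_r; [lra | ].
      eapply Rle_trans; [apply re_le_Cmod | apply HB, Hc]. }
  assert (Hi : Rabs (Im (f b) - Im (f a)) <= B * (b - a)).
  { destruct (MVT_gen (fun t => Im (f t)) a b (fun t => Im (f' t))) as [c [Hc E]].
    - rewrite Rmin_left, Rmax_right by exact Hab. intros t Ht. apply Hd; lra.
    - rewrite Rmin_left, Rmax_right by exact Hab. intros t Ht.
      apply continuity_pt_filterlim, (@ex_derive_continuous R_AbsRing R_NormedModule).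
      exists (Im (f' t)); exact (proj2 (Hd t Ht)).
    - rewrite Rmin_left, Rmax_right in Hc by exact Hab. rewrite E, Rabs_mult, (Rabs_pos_eq (b - a)) by lra.
      apply Rmult_le_compat_r; [lra | ].
      eapply Rle_trans; [apply Im_le_Cmod | apply HB, Hc]. }
  eapply Rle_trans; [apply Cmod_le_sum | ].
  replace (Re (f b - f a)%C) with (Re (f b) - Re (f a)) by (unfold Re, Im; simpl; ring).
  replace (Im (f b - f a)%C) with (Im (f b) - Im (f a)) by (unfold Re, Im; simpl; ring).
  lra.
Qed.

(** The mean value inequality along the segment from [0] to [z], used twice: first for
    [Cexp] and then for [Cexp (t z) - t z]. *)
Lemma Cexp_remainder (z : C) :
  Cmod (Cexp z - 1 - z) <= 4 * (Cmod z)² * exp (Cmod z).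
Proof.
  set (r := Cmod z). assert (Hr : 0 <= r) by apply Cmod_ge_0.
  assert (Hlin : forall t, Cderiv (fun t => (RtoC t * z)%C) t z).
  { intros t; split; simpl; auto_derive; trivial; unfold Re, Im; ring. }
  assert (He : forall t, t <= 1 -> 0 <= t -> exp (Re (RtoC t * z)%C) <= exp r).
  { intros t H1 H0.
    assert (Re (RtoC t * z)%C <= r).
    { eapply Rle_trans; [apply Rle_abs | ]. eapply Rle_trans; [apply re_le_Cmod | ].
      rewrite Cmod_mult, Cmod_R, Rabs_pos_eq by exact H0. fold r. nra. }
    destruct (Rle_lt_or_eq_dec _ _ H) as [L | E]; [left; now apply exp_increasing | rewrite E; lra]. }
  assert (H1 : forall t, 0 <= t <= 1 -> Cmod (Cexp (RtoC t * z) - 1) <= 2 * r * exp r).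
  { intros t [Ht0 Ht1].
    assert (M := Cderiv_mean_value (fun t => Cexp (RtoC t * z)) (fun t => (z * Cexp (RtoC t * z))%C) 0 t (r * exp r) Ht0).
    cbv beta in M. rewrite Cmult_0_l, Cexp_0 in M.
    eapply Rle_trans; [apply M | ].
    - intros s Hs. apply Cderiv_exp, Hlin.
    - intros s Hs. rewrite Cmod_mult, Cmod_Cexp. fold r.
      apply Rmult_le_compat_l; [exact Hr | apply He; lra].
    - generalize (exp_pos r); intros. assert (0 <= r * exp r) by nra. nra. }
  assert (M := Cderiv_mean_value (fun t => (Cexp (RtoC t * z) - RtoC t * z)%C)
    (fun t => (z * (Cexp (RtoC t * z) - 1))%C) 0 1 (r * (2 * r * exp r)) Rle_0_1).
  cbv beta in M. replace (Cexp z - 1 - z)%C with (Cexp (1 * z) - 1 * z - (Cexp (0 * z) - 0 * z))%C.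
  - eapply Rle_trans; [apply M | unfold Rsqr; lra].
    + intros t Ht. eapply Cderiv_eq; [apply Cderiv_minus; [apply Cderiv_exp | ]; apply Hlin | ]. cbv beta. ring.
    + intros t Ht. rewrite Cmod_mult. fold r. apply Rmult_le_compat_l; [exact Hr | apply H1, Ht].
  - rewrite Cmult_0_l, Cmult_1_l, Cexp_0. ring.
Qed.

(** * Convergence of complex sequences and series *)

Definition Ctends (f : nat -> C) (l : C) : Prop :=
  forall eps, 0 < eps -> exists N, forall n, (N <= n)%nat -> Cmod (f n - l) < eps.

Notation Cis_series := (@is_series C_AbsRing C_NormedModule).

Lemma Ctends_filterlim (f : nat -> C) (l : C) :
  filterlim f eventually (locally (l : C_NormedModule)) <-> Ctends f l.
Proof.
  rewrite filterlim_locally_ball_norm. split; intros H.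
  - intros eps He. exact (H (mkposreal eps He)).
  - intros eps. exact (H eps (cond_pos eps)).
Qed.

Lemma is_series_Ctends (f : nat -> C) (l : C) :
  Cis_series f l <-> Ctends (sum_n f) l.
Proof. apply Ctends_filterlim. Qed.

Lemma Ctends_unique f l l' : Ctends f l -> Ctends f l' -> l = l'.
Proof.
  rewrite <- !Ctends_filterlim. apply (@filterlim_locally_unique nat C_AbsRing C_NormedModule).
  apply Proper_StrongProper, eventually_filter.
Qed.

Lemma Ctends_ext f g l : (forall n, f n = g n) -> Ctends f l -> Ctends g l.
Proof. intros E H. replace g with f; [exact H | ]. now apply functional_extensionality. Qed.

Lemma Ctends_plus f g a b :
  Ctends f a -> Ctends g b -> Ctends (fun n => (f n + g n)%C) (a + b)%C.
Proof.
  intros Hf Hg eps He.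
  destruct (Hf (eps / 2)) as [N1 H1]; [lra | ]. destruct (Hg (eps / 2)) as [N2 H2]; [lra | ].
  exists (N1 + N2)%nat. intros n Hn.
  replace (f n + g n - (a + b))%C with ((f n - a) + (g n - b))%C by ring.
  eapply Rle_lt_trans; [apply Cmod_triangle | ].
  specialize (H1 n ltac:(lia)). specialize (H2 n ltac:(lia)). lra.
Qed.

Lemma Ctends_const c : Ctends (fun _ => c) c.
Proof.
  intros eps He. exists O. intros n _. replace (c - c)%C with (RtoC 0) by ring.
  now rewrite Cmod_0.
Qed.

Lemma Ctends_scal c f a : Ctends f a -> Ctends (fun n => (c * f n)%C) (c * a)%C.
Proof.
  intros Hf eps He. generalize (Cmod_ge_0 c); intros Hc.
  destruct (Hf (eps / (Cmod c + 1))) as [N H]; [apply Rdiv_lt_0_compat; lra | ].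
  exists N. intros n Hn. specialize (H n Hn).
  replace (c * f n - c * a)%C with (c * (f n - a))%C by ring. rewrite Cmod_mult.
  generalize (Cmod_ge_0 (f n - a)); intros.
  apply Rle_lt_trans with ((Cmod c + 1) * Cmod (f n - a)); [nra | ].
  apply Rlt_le_trans with ((Cmod c + 1) * (eps / (Cmod c + 1))); [nra | ].
  right; field; lra.
Qed.

Lemma Ctends_subseq f l (u : nat -> nat) :
  (forall n, (n <= u n)%nat) -> Ctends f l -> Ctends (fun n => f (u n)) l.
Proof.
  intros Hu H eps He. destruct (H eps He) as [N HN]. exists N. intros n Hn.
  apply HN. specialize (Hu n). lia.
Qed.

Lemma Ctends_squeeze f (g : nat -> R) :
  (forall n, Cmod (f n) <= g n) -> is_lim_seq g 0 -> Ctends f 0.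
Proof.
  intros Hfg Hg eps He. apply is_lim_seq_spec in Hg.
  destruct (Hg (mkposreal eps He)) as [N HN]. exists N. intros n Hn.
  specialize (HN n Hn). simpl in HN. rewrite Rminus_0_r in HN.
  replace (f n - 0)%C with (f n) by ring.
  eapply Rle_lt_trans; [apply Hfg | ]. eapply Rle_lt_trans; [apply Rle_abs | exact HN].
Qed.

Lemma Cmod_minus_sym (a b : C) : Cmod (a - b) = Cmod (b - a).
Proof. rewrite <- Cmod_opp. f_equal. ring. Qed.

Lemma Ctends_Cmod_le f l B : (forall n, Cmod (f n) <= B) -> Ctends f l -> Cmod l <= B.
Proof.
  intros Hf H. apply Rnot_lt_le. intros Hl.
  destruct (H (Cmod l - B)) as [N HN]; [lra | ].
  specialize (HN N (le_n _)). specialize (Hf N).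
  assert (T := Cmod_triangle (f N) (l - f N)).
  replace (f N + (l - f N))%C with l in T by ring.
  rewrite Cmod_minus_sym in HN. lra.
Qed.

(** * A summable majorant *)

(** Preferred to an inverse square because its partial sums telescope to an explicit
    value. *)
Definition inv_pronic (n : nat) : R := / (INR (S n) * INR (S (S n))).

Lemma inv_pronic_pos n : 0 < inv_pronic n.
Proof.
  apply Rinv_0_lt_compat, Rmult_lt_0_compat; apply lt_0_INR; lia.
Qed.

Lemma sum_inv_pronic n : sum_n inv_pronic n = 1 - / INR (S (S n)).
Proof.
  induction n as [ | n IH].
  - rewrite sum_O. unfold inv_pronic. simpl. field.
  - rewrite sum_Sn, IH.
    change (1 - / INR (S (S n)) + / (INR (S (S n)) * INR (S (S (S n))))
            = 1 - / INR (S (S (S n)))).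
    assert (0 < INR (S (S n))) by (apply lt_0_INR; lia).
    rewrite (S_INR (S (S n))). field. lra.
Qed.

Lemma is_lim_inv_S : is_lim_seq (fun n => / INR (S n)) 0.
Proof.
  apply (is_lim_seq_incr_1 (fun n => / INR n)).
  replace (Finite 0) with (Rbar_inv p_infty) by reflexivity.
  apply is_lim_seq_inv; [apply is_lim_seq_INR | discriminate].
Qed.

Lemma is_lim_inv_pronic : is_lim_seq inv_pronic 0.
Proof.
  apply is_lim_seq_le_le with (u := fun _ => 0) (w := fun n => / INR (S n)).
  - intros n. split; [left; apply inv_pronic_pos | ].
    unfold inv_pronic. rewrite Rinv_mult.
    assert (0 < / INR (S n)) by (apply Rinv_0_lt_compat, lt_0_INR; lia).
    assert (/ INR (S (S n)) <= 1).
    { rewrite <- Rinv_1. apply Rinv_le_contravar; [lra | ].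
      rewrite S_INR. generalize (pos_INR (S n)); lra. }
    nra.
  - apply is_lim_seq_const.
  - apply is_lim_inv_S.
Qed.

Lemma ex_series_majorized (f : nat -> C) (B : R) :
  (forall n, Cmod (f n) <= B * inv_pronic n) ->
  exists l, Cis_series f l /\ Cmod l <= B.
Proof.
  intros H.
  assert (HB : 0 <= B).
  { specialize (H O). generalize (Cmod_ge_0 (f O)), (inv_pronic_pos O); intros.
    apply Rnot_lt_le. intros ?. nra. }
  destruct (@ex_series_le C_AbsRing C_CompleteNormedModule f (fun n => B * inv_pronic n)) as [l Hl].
  - exact H.
  - apply (ex_series_scal_l B inv_pronic). exists (1 - 0).
    cut (is_lim_seq (sum_n inv_pronic) (1 - 0)); [intros L; exact L | ].
    apply (is_lim_seq_ext (fun n => 1 - / INR (S (S n)))).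
    + intros n. symmetry. apply sum_inv_pronic.
    + apply is_lim_seq_minus'; [apply is_lim_seq_const | ].
      apply (is_lim_seq_incr_1 (fun n => / INR (S n))), is_lim_inv_S.
  - exists l. split; [exact Hl | ].
    apply is_series_Ctends in Hl.
    eapply Ctends_Cmod_le; [ | exact Hl].
    intros n. eapply Rle_trans with (B * sum_n inv_pronic n).
    + induction n as [ | n IH].
      * rewrite !sum_O. apply H.
      * rewrite !sum_Sn. eapply Rle_trans; [apply Cmod_triangle | ].
        unfold plus; simpl. specialize (H (S n)). unfold plus in IH; simpl in IH. lra.
    + rewrite sum_inv_pronic.
      assert (0 < / INR (S (S n))) by (apply Rinv_0_lt_compat, lt_0_INR; lia). nra.
Qed.

(** * The Euler transformation *)

Definition alt (b : nat -> C) (m : nat) : C := ((- (1)) ^ m * b m)%C.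

Definition fdiff (b : nat -> C) (m : nat) : C := (b m - b (S m))%C.

Fixpoint fdiffn (N : nat) (b : nat -> C) : nat -> C :=
  match N with O => b | S N => fdiffn N (fdiff b) end.

Definition series_sum (f : nat -> C) : C := epsilon (inhabits (RtoC 0)) (Cis_series f).

(** Only the alternating series of the [N]-th differences is summed; the previous stages
    are undone by the finite recursion. Hence the value can exist when [alt b] itself
    diverges. *)
Fixpoint euler (N : nat) (b : nat -> C) : C :=
  match N with
  | O => series_sum (alt b)
  | S N => ((b O + euler N (fdiff b)) / 2)%C
  end.

Lemma series_sum_unique f l : Cis_series f l -> series_sum f = l.
Proof.
  intros H. assert (H' : Cis_series f (series_sum f)).
  { unfold series_sum. apply epsilon_spec. now exists l. }
  apply is_series_Ctends in H. apply is_series_Ctends in H'.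
  now apply (Ctends_unique (sum_n f)).
Qed.

Lemma Cmod_m1_pow n : Cmod ((- (1)) ^ n)%C = 1.
Proof.
  induction n as [ | n IH]; simpl.
  - apply Cmod_1.
  - now rewrite Cmod_mult, IH, Cmod_opp, Cmod_1, Rmult_1_l.
Qed.

Lemma Cmod_alt b m : Cmod (alt b m) = Cmod (b m).
Proof. unfold alt. now rewrite Cmod_mult, Cmod_m1_pow, Rmult_1_l. Qed.

(** Shifting the second half of the differences by one index reproduces the alternating
    sum, up to its two boundary terms. *)
Lemma sum_alt_fdiff b n :
  (sum_n (alt (fdiff b)) n = 2 * sum_n (alt b) n - b O - (- (1)) ^ n * b (S n))%C.
Proof.
  induction n as [ | n IH].
  - rewrite !sum_O. unfold alt, fdiff. simpl. ring.
  - rewrite !sum_Sn, IH. change plus with Cplus. unfold alt, fdiff. simpl. ring.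
Qed.

Lemma Ctends_alt_succ b : Ctends b 0 -> Ctends (fun n => ((- (1)) ^ n * b (S n))%C) 0.
Proof.
  intros Hb eps He. destruct (Hb eps He) as [N HN]. exists N. intros n Hn.
  replace ((- (1)) ^ n * b (S n) - 0)%C with ((- (1)) ^ n * (b (S n) - 0))%C by ring.
  rewrite Cmod_mult, Cmod_m1_pow, Rmult_1_l. apply HN. lia.
Qed.

Lemma euler_step_up b l :
  Ctends b 0 -> Cis_series (alt b) l -> Cis_series (alt (fdiff b)) (2 * l - b O)%C.
Proof.
  rewrite !is_series_Ctends. intros Hb Hl.
  assert (Hz := Ctends_alt_succ b Hb).
  apply (Ctends_ext (fun n => (2 * sum_n (alt b) n + (- b O + (- (1)) * ((- (1)) ^ n * b (S n))))%C)).
  - intros n. rewrite sum_alt_fdiff. ring.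
  - replace (2 * l - b O)%C with (2 * l + (- b O + (- (1)) * 0))%C by ring.
    apply Ctends_plus; [apply Ctends_scal, Hl | ].
    apply Ctends_plus; [apply Ctends_const | apply Ctends_scal, Hz].
Qed.

Lemma euler_step_down b l :
  Ctends b 0 -> Cis_series (alt (fdiff b)) l -> Cis_series (alt b) ((b O + l) / 2)%C.
Proof.
  rewrite !is_series_Ctends. intros Hb Hl.
  assert (Hz := Ctends_alt_succ b Hb).
  apply (Ctends_ext (fun n => (/ 2 * (b O + (sum_n (alt (fdiff b)) n + (- (1)) ^ n * b (S n))))%C)).
  - intros n. rewrite sum_alt_fdiff. field.
  - replace ((b O + l) / 2)%C with (/ 2 * (b O + (l + 0)))%C by field.
    apply Ctends_scal, Ctends_plus; [apply Ctends_const | ].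
    apply Ctends_plus; [exact Hl | exact Hz].
Qed.

Lemma Ctends_fdiff b : Ctends b 0 -> Ctends (fdiff b) 0.
Proof.
  intros H. apply (Ctends_ext (fun n => (b n + (- (1)) * b (S n))%C)).
  - intros n. unfold fdiff. ring.
  - replace (RtoC 0) with (0 + (- (1)) * 0)%C by ring.
    apply Ctends_plus; [exact H | ]. apply Ctends_scal.
    apply (Ctends_subseq b 0 S); [intros; lia | exact H].
Qed.

(** The transformation is consistent with summation of a null sequence; this is what makes
    the continuation agree with the defining series when [0 < Re s]. *)
Lemma euler_series N b l :
  Ctends b 0 -> Cis_series (alt (fdiffn N b)) l -> Cis_series (alt b) (euler N b).
Proof.
  revert b. induction N as [ | N IH]; simpl; intros b Hb Hl.
  - rewrite (series_sum_unique _ l); exact Hl.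
  - apply euler_step_down; [exact Hb | ].
    apply IH; [apply Ctends_fdiff, Hb | exact Hl].
Qed.

Lemma fdiffn_S N b : fdiffn (S N) b = fdiff (fdiffn N b).
Proof. revert b. induction N as [ | N IH]; intros b; [reflexivity | ]. exact (IH (fdiff b)). Qed.

(** The value is independent of the number of steps as soon as the innermost series
    converges. This allows the number of steps to vary with the exponent. *)
Lemma euler_S N b l :
  Ctends (fdiffn N b) 0 -> Cis_series (alt (fdiffn N b)) l -> euler (S N) b = euler N b.
Proof.
  revert b. induction N as [ | N IH]; intros b Hb Hl.
  - simpl in *. rewrite (series_sum_unique (alt b) l Hl).
    rewrite (series_sum_unique _ _ (euler_step_up b l Hb Hl)).
    field.
  - change (euler (S (S N)) b) with ((b O + euler (S N) (fdiff b)) / 2)%C.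
    change (euler (S N) b) with ((b O + euler N (fdiff b)) / 2)%C.
    now rewrite IH.
Qed.

Lemma euler_linear N (a b c : nat -> C) (h la lb lc : C) :
  Cis_series (alt (fdiffn N a)) la -> Cis_series (alt (fdiffn N b)) lb ->
  Cis_series (alt (fdiffn N c)) lc ->
  euler N (fun m => (a m - b m - h * c m)%C)
  = (euler N a - euler N b - h * euler N c)%C.
Proof.
  revert a b c. induction N as [ | N IH]; intros a b c Ha Hb Hc.
  - simpl in *. rewrite (series_sum_unique _ _ Ha), (series_sum_unique _ _ Hb), (series_sum_unique _ _ Hc).
    apply series_sum_unique. rewrite is_series_Ctends in *.
    apply (Ctends_ext (fun n => (sum_n (alt a) n + ((- (1)) * sum_n (alt b) n + (- h) * sum_n (alt c) n))%C)).
    + induction n as [ | n IH].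
      * rewrite !sum_O. unfold alt. ring.
      * rewrite !sum_Sn, <- IH. change plus with Cplus. unfold alt. ring.
    + replace (la - lb - h * lc)%C with (la + ((- (1)) * lb + (- h) * lc))%C by ring.
      apply Ctends_plus; [exact Ha | ]. apply Ctends_plus; apply Ctends_scal; assumption.
  - simpl. replace (fdiff (fun m => (a m - b m - h * c m)%C))
      with (fun m => (fdiff a m - fdiff b m - h * fdiff c m)%C).
    + rewrite IH by assumption. field.
    + apply functional_extensionality. intros m. unfold fdiff. ring.
Qed.

(** The constant [K] depends on the majorants but not on the scale [e]. With [e]
    the square of an increment, this turns termwise remainder estimates into a remainder
    estimate for the transformed sum. *)
Lemma euler_bound N (w : nat -> R) (B : R) :
  exists K, forall (b : nat -> C) (e : R), 0 <= e ->
    (forall m, Cmod (b m) <= w m * e) ->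
    (forall m, Cmod (fdiffn N b m) <= B * e * inv_pronic m) ->
    Cmod (euler N b) <= K * e.
Proof.
  revert w. induction N as [ | N IH]; intros w.
  - exists B. intros b e He Hb HN. simpl in *.
    destruct (ex_series_majorized (alt b) (B * e)) as [l [Hl Hle]].
    + intros n. rewrite Cmod_alt. apply HN.
    + now rewrite (series_sum_unique _ _ Hl).
  - destruct (IH (fun m => w m + w (S m))) as [K HK].
    exists ((w O + K) / 2). intros b e He Hb HN. simpl.
    unfold Cdiv. rewrite Cmod_mult, Cmod_inv, Cmod_R, (Rabs_pos_eq 2) by (lra || (intros E; apply (f_equal fst) in E; simpl in E; lra)).
    specialize (HK (fdiff b) e He).
    assert (T := Cmod_triangle (b O) (euler N (fdiff b))).
    assert (Cmod (euler N (fdiff b)) <= K * e).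
    { apply HK; [ | exact HN]. intros m. unfold fdiff.
      assert (T' := Cmod_triangle (b m) (- b (S m))). rewrite Cmod_opp in T'.
      unfold Cminus. generalize (Hb m), (Hb (S m)). lra. }
    generalize (Hb O). lra.
Qed.

(** * Differences of smooth functions *)

(** The [N]-th difference is controlled by the [N]-th derivative: one difference trades one
    derivative for a factor 2, by the mean value inequality. *)
Lemma fdiffn_smooth N (g : nat -> R -> C) (B : R) (m : nat) :
  (forall j t, 0 <= t -> Cderiv (g j) t (g (S j) t)) ->
  (forall t, INR m <= t -> Cmod (g N t) <= B) ->
  Cmod (fdiffn N (fun k => g O (INR k)) m) <= 2 ^ N * B.
Proof.
  revert g B. induction N as [ | N IH]; intros g B Hd HB.
  - simpl. rewrite Rmult_1_l. apply HB, Rle_refl.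
  - simpl fdiffn.
    replace (fdiff (fun k => g O (INR k)))
      with (fun k => (fun j t => (g j t - g j (t + 1)%R)%C) O (INR k))
      by (apply functional_extensionality; intros k; unfold fdiff; now rewrite S_INR).
    replace (2 ^ S N * B) with (2 ^ N * (2 * B)) by (simpl; ring).
    apply (IH (fun j t => (g j t - g j (t + 1)%R)%C)).
    + intros j t Ht. apply Cderiv_minus; [apply Hd, Ht | apply Cderiv_shift, Hd; lra].
    + intros t Ht. rewrite Cmod_minus_sym.
      generalize (pos_INR m); intros Hm.
      eapply Rle_trans; [apply (Cderiv_mean_value (g N) (g (S N)) t (t + 1) B) | ]; try lra.
      * intros s Hs. apply Hd. lra.
      * intros s Hs. apply HB. lra.
Qed.

Lemma fdiffn_majorized N (g : nat -> R -> C) (B : R) (m : nat) :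
  0 <= B ->
  (forall j t, 0 <= t -> Cderiv (g j) t (g (S j) t)) ->
  (forall t, 0 <= t -> Cmod (g N t) <= B * exp (- 2 * ln (1 + t))) ->
  Cmod (fdiffn N (fun k => g O (INR k)) m) <= 2 ^ S N * B * inv_pronic m.
Proof.
  intros HB Hd Hg.
  eapply Rle_trans; [apply (fdiffn_smooth N g (B * (2 * inv_pronic m))) | simpl; lra].
  - exact Hd.
  - intros t Ht. generalize (pos_INR m); intros Hm.
    eapply Rle_trans; [apply Hg; lra | ]. apply Rmult_le_compat_l; [exact HB | ].
    replace (- 2 * ln (1 + t)) with (- (ln (1 + t) + ln (1 + t))) by ring.
    rewrite exp_Ropp, exp_plus, exp_ln by lra.
    unfold inv_pronic. rewrite !S_INR.
    replace (2 * / ((INR m + 1) * (INR m + 1 + 1)))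
      with (/ ((INR m + 1) * ((INR m + 1 + 1) / 2))) by (field; lra).
    apply Rinv_le_contravar; nra.
Qed.

(** * Growth of the principal logarithm *)

Lemma exp_le x y : x <= y -> exp x <= exp y.
Proof.
  intros [H | H]; [left; now apply exp_increasing | subst; apply Rle_refl].
Qed.

(** [|t + x|] lies between two positive multiples of [1 + t], so up to a bounded error
    the logarithm is the real function [ln (1 + t)], in which later estimates are
    expressed. *)
Lemma Clog_bound (x : C) :
  0 < Re x ->
  exists K, 0 <= K /\ forall t, 0 <= t ->
    Rabs (Re (Clog (RtoC t + x)) - ln (1 + t)) <= K /\
    Rabs (Im (Clog (RtoC t + x))) <= K /\
    Cmod (Clog (RtoC t + x)) <= ln (1 + t) + K.
Proof.
  intros Hx. set (c := Rmin (Re x) 1). set (d := Cmod x + 1).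
  assert (Hc : 0 < c) by (apply Rmin_pos; lra).
  assert (Hc1 : c <= Re x) by apply Rmin_l.
  assert (Hc2 : c <= 1) by apply Rmin_r.
  assert (Hd : 0 < d) by (generalize (Cmod_ge_0 x); unfold d; lra).
  generalize PI_RGT_0; intros Hpi.
  exists (Rabs (ln c) + Rabs (ln d) + PI).
  generalize (Rabs_pos (ln c)), (Rabs_pos (ln d)); intros Hlc Hld.
  split; [lra | ]. intros t Ht.
  assert (HR : Re (RtoC t + x)%C = t + Re x) by reflexivity.
  assert (Hlow : c * (1 + t) <= Cmod (RtoC t + x)).
  { eapply Rle_trans; [ | apply re_le_Cmod]. rewrite HR, Rabs_pos_eq by lra. nra. }
  assert (Hupp : Cmod (RtoC t + x) <= d * (1 + t)).
  { eapply Rle_trans; [apply Cmod_triangle | ]. rewrite Cmod_R, Rabs_pos_eq by exact Ht.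
    unfold d. generalize (Cmod_ge_0 x). nra. }
  assert (Hl1 : ln c + ln (1 + t) <= ln (Cmod (RtoC t + x))).
  { rewrite <- ln_mult by lra. apply ln_le; [nra | exact Hlow]. }
  assert (Hl2 : ln (Cmod (RtoC t + x)) <= ln d + ln (1 + t)).
  { rewrite <- ln_mult by lra. apply ln_le; [nra | exact Hupp]. }
  assert (Hl0 : 0 <= ln (1 + t)).
  { rewrite <- ln_1. apply ln_le; lra. }
  assert (Har : Rabs (Carg (RtoC t + x)) <= PI / 2).
  { rewrite Carg_right by (rewrite HR; lra).
    destruct (atan_bound (Im (RtoC t + x) / Re (RtoC t + x))). apply Rabs_le. lra. }
  assert (H1 : Rabs (ln (Cmod (RtoC t + x)) - ln (1 + t)) <= Rabs (ln c) + Rabs (ln d)).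
  { apply Rabs_le. generalize (Rle_abs (ln d)), (Rle_abs (- ln c)). rewrite Rabs_Ropp. lra. }
  split; [ | split]; simpl.
  - lra.
  - lra.
  - eapply Rle_trans; [apply Cmod_le_sum | ]. simpl.
    assert (Rabs (ln (Cmod (RtoC t + x))) <= ln (1 + t) + (Rabs (ln c) + Rabs (ln d))).
    { replace (ln (Cmod (RtoC t + x)))
        with (ln (1 + t) + (ln (Cmod (RtoC t + x)) - ln (1 + t))) by ring.
      eapply Rle_trans; [apply Rabs_triang | ]. rewrite (Rabs_pos_eq (ln (1 + t))) by exact Hl0. lra. }
    lra.
Qed.

(** * Powers as functions of base and exponent *)

(** The coefficient [(-1)^j s (s+1) ... (s+j-1)] of the [j]-th derivative of a power. *)
Fixpoint poch (j : nat) (s : C) : C :=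
  match j with
  | O => 1
  | S j => (- (s + RtoC (INR j)) * poch j s)%C
  end.

Fixpoint poch_deriv (j : nat) (s : C) : C :=
  match j with
  | O => 0
  | S j => (- poch j s - (s + RtoC (INR j)) * poch_deriv j s)%C
  end.

Lemma poch_remainder j s :
  exists A, 0 <= A /\ forall h, Cmod h <= 1 ->
    Cmod (poch j (s + h) - poch j s - h * poch_deriv j s) <= A * (Cmod h)².
Proof.
  induction j as [ | j [A [HA IH]]].
  - exists 0. split; [lra | ]. intros h Hh. simpl.
    replace (1 - 1 - h * 0)%C with (RtoC 0) by ring. rewrite Cmod_0. lra.
  - set (p := poch j s) in *. set (p' := poch_deriv j s) in *. set (q := (s + RtoC (INR j))%C).
    generalize (Cmod_ge_0 q), (Cmod_ge_0 p'); intros Hq Hp'.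
    exists (Cmod q * A + (A + Cmod p')). split; [nra | ]. intros h Hh.
    specialize (IH h Hh). generalize (Cmod_ge_0 h); intros Hh0.
    simpl. fold p p' q.
    set (r := (poch j (s + h) - p - h * p')%C) in *.
    replace (- (s + h + RtoC (INR j)) * poch j (s + h) - - q * p - h * (- p - q * p'))%C
      with (- (q * r) - h * (r + h * p'))%C by (unfold r, q; ring).
    eapply Rle_trans; [apply Cmod_triangle | ]. rewrite !Cmod_opp, !Cmod_mult.
    assert (T := Cmod_triangle r (h * p')). rewrite Cmod_mult in T.
    unfold Rsqr in *.
    assert (Cmod q * Cmod r <= Cmod q * (A * (Cmod h * Cmod h))) by (apply Rmult_le_compat_l; lra).
    assert (A * (Cmod h * Cmod h) <= A * Cmod h) by (apply Rmult_le_compat_l; nra).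
    assert (Cmod h * Cmod (r + h * p') <= Cmod h * (A * Cmod h + Cmod h * Cmod p'))
      by (apply Rmult_le_compat_l; lra).
    nra.
Qed.

Definition shifted_pow (x s : C) (j : nat) (t : R) : C :=
  Cexp (- (s + RtoC (INR j)) * Clog (RtoC t + x)).

(** The [j]-th derivative of [(t + x)^(-s)] with respect to [t]. *)
Definition pow_deriv (x s : C) (j : nat) (t : R) : C := (poch j s * shifted_pow x s j t)%C.

(** The derivative of [pow_deriv] with respect to the exponent [s]. *)
Definition pow_deriv_exponent (x s : C) (j : nat) (t : R) : C :=
  ((poch_deriv j s - poch j s * Clog (RtoC t + x)) * shifted_pow x s j t)%C.

Section Powers.

Variable x : C.
Hypothesis Hx : 0 < Re x.

Lemma Cderiv_log t : 0 <= t ->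
  Cderiv (fun t => Clog (RtoC t + x)) t (/ (RtoC t + x))%C.
Proof. intros Ht. apply Cderiv_Clog. lra. Qed.

Lemma shifted_pow_S s j t : 0 <= t -> (/ (RtoC t + x) * shifted_pow x s j t)%C = shifted_pow x s (S j) t.
Proof.
  intros Ht. unfold shifted_pow.
  assert (Hr : 0 < Re (RtoC t + x)%C) by (simpl; unfold Re in Hx; lra).
  rewrite <- (Cexp_Clog _ Hr) at 1. rewrite <- Cexp_opp, <- Cexp_plus. f_equal.
  rewrite S_INR, RtoC_plus. ring.
Qed.

Lemma Cderiv_shifted_pow s j t : 0 <= t ->
  Cderiv (shifted_pow x s j) t (- (s + RtoC (INR j)) * shifted_pow x s (S j) t)%C.
Proof.
  intros Ht. rewrite <- shifted_pow_S by exact Ht. eapply Cderiv_eq.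
  - apply Cderiv_exp, Cderiv_scal, Cderiv_log, Ht.
  - unfold shifted_pow. ring.
Qed.

Lemma Cderiv_pow_deriv s j t : 0 <= t -> Cderiv (pow_deriv x s j) t (pow_deriv x s (S j) t).
Proof.
  intros Ht. eapply Cderiv_eq; [apply Cderiv_scal, Cderiv_shifted_pow, Ht | ].
  unfold pow_deriv. simpl poch. ring.
Qed.

(** Differentiation in [t] and in [s] commute: the [s]-derivatives form a chain of
    [t]-derivatives as well. *)
Lemma Cderiv_pow_deriv_exponent s j t : 0 <= t -> Cderiv (pow_deriv_exponent x s j) t (pow_deriv_exponent x s (S j) t).
Proof.
  intros Ht. eapply Cderiv_eq.
  - apply Cderiv_mult; [ | apply Cderiv_shifted_pow, Ht].
    apply Cderiv_minus; [apply Cderiv_const | apply Cderiv_scal, Cderiv_log, Ht].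
  - cbv beta. unfold pow_deriv_exponent. simpl poch. simpl poch_deriv.
    rewrite <- shifted_pow_S by exact Ht. ring.
Qed.

Definition pow_deriv_rem (s h : C) (j : nat) (t : R) : C :=
  (pow_deriv x (s + h) j t - pow_deriv x s j t - h * pow_deriv_exponent x s j t)%C.

Lemma Cderiv_pow_deriv_rem s h j t : 0 <= t ->
  Cderiv (pow_deriv_rem s h j) t (pow_deriv_rem s h (S j) t).
Proof.
  intros Ht. apply Cderiv_minus.
  - apply Cderiv_minus; apply Cderiv_pow_deriv, Ht.
  - apply Cderiv_scal, Cderiv_pow_deriv_exponent, Ht.
Qed.

(** The exponent 4 leaves room for the factor [(1 + t)^2] lost in the remainder, and for an
    inverse square to make the series converge. *)
Lemma shifted_pow_bound s j :
  4 <= Re s + INR j ->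
  exists M, 0 <= M /\ forall t, 0 <= t -> Cmod (shifted_pow x s j t) <= M * exp (- 4 * ln (1 + t)).
Proof.
  intros Hs. destruct (Clog_bound x Hx) as [K [HK HL]].
  exists (exp ((Re s + INR j) * K + Rabs (Im s) * K)). split; [left; apply exp_pos | ].
  intros t Ht. destruct (HL t Ht) as [H1 [H2 _]].
  unfold shifted_pow. rewrite Cmod_Cexp, <- exp_plus. apply exp_le.
  set (l := Clog (RtoC t + x)) in *.
  replace (Re (- (s + RtoC (INR j)) * l)%C)
    with (- (Re s + INR j) * Re l + Im s * Im l) by (unfold Re, Im; simpl; ring).
  assert (Hl0 : 0 <= ln (1 + t)) by (rewrite <- ln_1; apply ln_le; lra).
  assert (Im s * Im l <= Rabs (Im s) * K).
  { eapply Rle_trans; [apply Rle_abs | ]. rewrite Rabs_mult.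
    apply Rmult_le_compat_l; [apply Rabs_pos | exact H2]. }
  apply Rabs_le_between in H1.
  assert ((Re s + INR j) * (ln (1 + t) - K) <= (Re s + INR j) * Re l)
    by (apply Rmult_le_compat_l; lra).
  nra.
Qed.

Lemma le_exp y : y <= exp y.
Proof. generalize (exp_ineq1_le y); lra. Qed.

Lemma sqr_le_exp y : 0 <= y -> y² <= 4 * exp y.
Proof.
  intros Hy. replace (exp y) with (exp (y / 2) * exp (y / 2))
    by (rewrite <- exp_plus; f_equal; field).
  generalize (le_exp (y / 2)); intros H. unfold Rsqr. nra.
Qed.

(** Factor out [(t + x)^(-s-j)]. What is left is the second order remainder of the product
    of a polynomial in [h] and [exp (- h l)], [l] the logarithm of [t + x], hence
    [O(|h|^2)] up to a factor [|l|^2 exp |l|]. For [|h| <= 1] that factor grows at most like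
    [(1 + t)^2]. *)
Lemma pow_deriv_rem_bound s j :
  exists A, 0 <= A /\ forall h t, Cmod h <= 1 -> 0 <= t ->
    Cmod (pow_deriv_rem s h j t)
    <= A * exp (2 * ln (1 + t)) * Cmod (shifted_pow x s j t) * (Cmod h)².
Proof.
  destruct (Clog_bound x Hx) as [K [HK HL]].
  destruct (poch_remainder j s) as [A0 [HA0 HP]].
  set (p := poch j s) in *. set (p' := poch_deriv j s) in *.
  set (A := A0 + Cmod p + Cmod p').
  generalize (Cmod_ge_0 p), (Cmod_ge_0 p'); intros Hp0 Hp0'.
  exists (18 * A * exp (2 * K)). split.
  { generalize (exp_pos (2 * K)). unfold A. nra. }
  intros h t Hh Ht. destruct (HL t Ht) as [_ [_ HLt]].
  assert (Hl0 : 0 <= ln (1 + t)) by (rewrite <- ln_1; apply ln_le; lra).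
  specialize (HP h Hh). generalize (Cmod_ge_0 h); intros Hh0.
  unfold pow_deriv_rem, pow_deriv, pow_deriv_exponent. fold p p'.
  set (l := Clog (RtoC t + x)) in *. set (ph := poch j (s + h)) in *.
  replace (shifted_pow x (s + h) j t) with (shifted_pow x s j t * Cexp (- (h * l)))%C
    by (unfold shifted_pow; rewrite <- Cexp_plus; f_equal; fold l; ring).
  set (e := shifted_pow x s j t).
  set (r1 := (ph - p - h * p')%C) in *.
  set (r2 := (Cexp (- (h * l)) - 1 - - (h * l))%C).
  replace (ph * (e * Cexp (- (h * l))) - p * e - h * ((p' - p * l) * e))%C
    with ((ph * r2 + r1 - (h * l) * (r1 + h * p')) * e)%C by (unfold r1, r2; ring).
  rewrite Cmod_mult.
  assert (Hr2 : Cmod r2 <= 4 * (Cmod h * Cmod l)² * exp (Cmod h * Cmod l)).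
  { generalize (Cexp_remainder (- (h * l))). now rewrite Cmod_opp, Cmod_mult. }
  set (y := ln (1 + t) + K) in *. assert (Hy : 0 <= y) by (unfold y; lra).
  generalize (Cmod_ge_0 l); intros Hl.
  assert (Hr2' : Cmod r2 <= 16 * (Cmod h)² * exp (2 * y)).
  { eapply Rle_trans; [exact Hr2 | ].
    assert (E1 : exp (Cmod h * Cmod l) <= exp y) by (apply exp_le; nra).
    assert (E2 : (Cmod l)² <= 4 * exp y).
    { eapply Rle_trans; [apply sqr_le_exp, Hl | ]. apply Rmult_le_compat_l; [lra | ]. now apply exp_le. }
    rewrite Rsqr_mult. replace (2 * y) with (y + y) by ring. rewrite exp_plus.
    assert (E3 : (Cmod l)² * exp (Cmod h * Cmod l) <= 4 * exp y * exp y).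
    { apply Rmult_le_compat; [apply Rle_0_sqr | left; apply exp_pos | exact E2 | exact E1]. }
    generalize (Rle_0_sqr (Cmod h)); intros. nra. }
  assert (Hph : Cmod ph <= A).
  { replace ph with (r1 + (p + h * p'))%C by (unfold r1; ring).
    assert (T1 := Cmod_triangle r1 (p + h * p')). assert (T2 := Cmod_triangle p (h * p')).
    rewrite Cmod_mult in T2. unfold Rsqr in HP.
    assert (A0 * (Cmod h * Cmod h) <= A0 * 1) by (apply Rmult_le_compat_l; nra).
    assert (Cmod h * Cmod p' <= 1 * Cmod p') by (apply Rmult_le_compat_r; assumption).
    unfold A. lra. }
  assert (Hd : Cmod (r1 + h * p') <= A * Cmod h).
  { assert (T1 := Cmod_triangle r1 (h * p')). rewrite Cmod_mult in T1. unfold Rsqr in HP.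
    assert (A0 * (Cmod h * Cmod h) <= A0 * Cmod h) by (apply Rmult_le_compat_l; nra).
    unfold A. nra. }
  assert (HA : 0 <= A) by (unfold A; lra).
  assert (H2y : 1 <= exp (2 * y)) by (rewrite <- exp_0 at 1; apply exp_le; lra).
  assert (Hly : Cmod l <= exp (2 * y)).
  { eapply Rle_trans; [exact HLt | ]. eapply Rle_trans; [apply le_exp | apply exp_le; lra]. }
  generalize (Rle_0_sqr (Cmod h)); intros Hhh.
  assert (Hmain : Cmod (ph * r2 + r1 - h * l * (r1 + h * p')) <= 18 * A * exp (2 * y) * (Cmod h)²).
  { eapply Rle_trans; [apply Cmod_triangle | ]. rewrite Cmod_opp.
    assert (T := Cmod_triangle (ph * r2) r1). rewrite !Cmod_mult in *.
    assert (B1 : Cmod ph * Cmod r2 <= A * (16 * (Cmod h)² * exp (2 * y)))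
      by (apply Rmult_le_compat; try apply Cmod_ge_0; assumption).
    assert (B2 : Cmod r1 <= A * exp (2 * y) * (Cmod h)²).
    { eapply Rle_trans; [exact HP | ]. apply Rmult_le_compat_r; [exact Hhh | ].
      unfold A. nra. }
    assert (B3 : Cmod h * Cmod l * Cmod (r1 + h * p') <= Cmod h * exp (2 * y) * (A * Cmod h)).
    { apply Rmult_le_compat; [nra | apply Cmod_ge_0 | nra | exact Hd]. }
    unfold Rsqr in *. lra. }
  replace (18 * A * exp (2 * K) * exp (2 * ln (1 + t)) * Cmod e * (Cmod h)²)
    with (18 * A * exp (2 * y) * (Cmod h)² * Cmod e).
  - apply Rmult_le_compat_r; [apply Cmod_ge_0 | exact Hmain].
  - replace (2 * y) with (2 * K + 2 * ln (1 + t)) by (unfold y; ring). rewrite exp_plus. ring.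
Qed.

Lemma pow_deriv_fdiffn s N :
  4 <= Re s + INR N ->
  exists B, forall m, Cmod (fdiffn N (fun k => pow_deriv x s O (INR k)) m) <= B * inv_pronic m.
Proof.
  intros Hs. destruct (shifted_pow_bound s N Hs) as [M [HM Hb]].
  exists (2 ^ S N * (Cmod (poch N s) * M)). intros m.
  generalize (Cmod_ge_0 (poch N s)); intros Hp.
  apply (fdiffn_majorized N (pow_deriv x s)).
  - nra.
  - intros; now apply Cderiv_pow_deriv.
  - intros t Ht. unfold pow_deriv. rewrite Cmod_mult, Rmult_assoc.
    apply Rmult_le_compat_l; [exact Hp | ].
    eapply Rle_trans; [apply Hb, Ht | ]. apply Rmult_le_compat_l; [exact HM | ].
    apply exp_le. assert (0 <= ln (1 + t)) by (rewrite <- ln_1; apply ln_le; lra). lra.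
Qed.

Lemma pow_deriv_exponent_fdiffn s N :
  4 <= Re s + INR N ->
  exists B, forall m, Cmod (fdiffn N (fun k => pow_deriv_exponent x s O (INR k)) m) <= B * inv_pronic m.
Proof.
  intros Hs. destruct (shifted_pow_bound s N Hs) as [M [HM Hb]].
  destruct (Clog_bound x Hx) as [K [HK HL]].
  set (A := Cmod (poch_deriv N s) + Cmod (poch N s) * exp K).
  generalize (Cmod_ge_0 (poch N s)), (Cmod_ge_0 (poch_deriv N s)), (exp_pos K); intros Hp Hp' HeK.
  assert (HA : 0 <= A) by (unfold A; nra).
  exists (2 ^ S N * (A * M)). intros m.
  apply (fdiffn_majorized N (pow_deriv_exponent x s)).
  - nra.
  - intros; now apply Cderiv_pow_deriv_exponent.
  - intros t Ht. destruct (HL t Ht) as [_ [_ HLt]].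
    assert (Hl0 : 0 <= ln (1 + t)) by (rewrite <- ln_1; apply ln_le; lra).
    unfold pow_deriv_exponent. rewrite Cmod_mult.
    assert (H1 : Cmod (poch_deriv N s - poch N s * Clog (RtoC t + x)) <= A * exp (ln (1 + t))).
    { eapply Rle_trans; [apply Cmod_triangle | ]. rewrite Cmod_opp, Cmod_mult.
      assert (Cmod (Clog (RtoC t + x)) <= exp K * exp (ln (1 + t))).
      { rewrite <- exp_plus. eapply Rle_trans; [ | apply le_exp]. lra. }
      assert (1 <= exp (ln (1 + t))) by (rewrite <- exp_0 at 1; apply exp_le; lra).
      unfold A. nra. }
    replace (A * M * exp (- 2 * ln (1 + t)))
      with ((A * exp (ln (1 + t))) * (M * exp (- 3 * ln (1 + t)))).
    + apply Rmult_le_compat; try apply Cmod_ge_0; [exact H1 | ].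
      eapply Rle_trans; [apply Hb, Ht | ]. apply Rmult_le_compat_l; [exact HM | ].
      apply exp_le. lra.
    + replace (- 2 * ln (1 + t)) with (ln (1 + t) + - 3 * ln (1 + t)) by ring.
      rewrite exp_plus. ring.
Qed.

Lemma pow_deriv_rem_fdiffn s N :
  4 <= Re s + INR N ->
  exists B, forall h m, Cmod h <= 1 ->
    Cmod (fdiffn N (fun k => pow_deriv_rem s h O (INR k)) m) <= B * (Cmod h)² * inv_pronic m.
Proof.
  intros Hs. destruct (shifted_pow_bound s N Hs) as [M [HM Hb]].
  destruct (pow_deriv_rem_bound s N) as [A [HA Hr]].
  exists (2 ^ S N * (A * M)). intros h m Hh.
  generalize (Rle_0_sqr (Cmod h)); intros Hhh.
  rewrite (Rmult_assoc (2 ^ S N)).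
  apply (fdiffn_majorized N (pow_deriv_rem s h)).
  - assert (0 <= A * M) by nra. nra.
  - intros; now apply Cderiv_pow_deriv_rem.
  - intros t Ht. eapply Rle_trans; [apply Hr; assumption | ].
    replace (A * M * (Cmod h)² * exp (- 2 * ln (1 + t)))
      with (A * exp (2 * ln (1 + t)) * (M * exp (- 4 * ln (1 + t))) * (Cmod h)²).
    + apply Rmult_le_compat_r; [exact Hhh | ].
      apply Rmult_le_compat_l; [ | apply Hb, Ht].
      generalize (exp_pos (2 * ln (1 + t))). nra.
    + replace (- 2 * ln (1 + t)) with (2 * ln (1 + t) + - 4 * ln (1 + t)) by ring.
      rewrite exp_plus. ring.
Qed.

End Powers.

(** * Complex derivatives *)

Notation Cis_derive := (@is_derive C_AbsRing C_NormedModule).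

(** On the domain of [f], neighbourhoods come from the absolute value, on its codomain from
    the product structure of the plane; the criterion removes this distinction. *)
Lemma Cis_derive_eps (f : C -> C) (s l : C) :
  Cis_derive f s l <->
  forall eps, 0 < eps -> exists delta, 0 < delta /\
    forall h, Cmod h < delta -> Cmod (f (s + h)%C - f s - h * l) <= eps * Cmod h.
Proof.
  split.
  - intros [_ H] eps He.
    destruct (H s (fun P HP => HP) (mkposreal eps He)) as [d Hd].
    exists d. split; [apply cond_pos | ]. intros h Hh.
    specialize (Hd (s + h)%C).
    assert (E : minus (s + h)%C s = h) by (change (s + h - s = h)%C; ring).
    assert (B : ball (s : AbsRing_UniformSpace C_AbsRing) d (s + h)%C).
    { change (Cmod (minus (s + h)%C s) < d). now rewrite E. }
    specialize (Hd B).
    change (Cmod (f (s + h)%C - f s - (s + h - s) * l) <= eps * Cmod (s + h - s)) in Hd.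
    replace (s + h - s)%C with h in Hd by ring. exact Hd.
  - intros H. split; [apply is_linear_scal_l | ].
    intros y Hy eps.
    apply (@is_filter_lim_locally_unique C_AbsRing (AbsRing_NormedModule C_AbsRing)) in Hy. subst y.
    destruct (H eps (cond_pos eps)) as [d [Hd0 Hd]].
    exists (mkposreal d Hd0). intros z Hz.
    specialize (Hd (z - s)%C Hz).
    assert (E : forall a b : C, (a + (b - a))%C = b) by (intros; ring).
    rewrite (E s z) in Hd. exact Hd.
Qed.

Lemma Cis_derive_quadratic (f : C -> C) (s l : C) (K : R) :
  (forall h, Cmod h <= 1 -> Cmod (f (s + h)%C - f s - h * l) <= K * (Cmod h)²) ->
  Cis_derive f s l.
Proof.
  intros H. apply Cis_derive_eps. intros eps He.
  set (K' := Rabs K + 1). generalize (Rabs_pos K), (Rle_abs K); intros HK0 HK.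
  exists (Rmin 1 (eps / K')). split.
  - apply Rmin_pos; [lra | ]. apply Rdiv_lt_0_compat; unfold K'; lra.
  - intros h Hh. generalize (Cmod_ge_0 h), (Rmin_l 1 (eps / K')), (Rmin_r 1 (eps / K')); intros H0 H1 H2.
    eapply Rle_trans; [apply H; lra | ].
    assert (K' * Cmod h <= eps).
    { apply Rle_trans with (K' * (eps / K')); [ | right; field; unfold K'; lra].
      apply Rmult_le_compat_l; unfold K' in *; lra. }
    unfold Rsqr, K' in *. nra.
Qed.

Lemma Ctends_inv_pronic f B : (forall m, Cmod (f m) <= B * inv_pronic m) -> Ctends f 0.
Proof.
  intros H. apply (Ctends_squeeze f _ H).
  replace (Finite 0) with (Rbar_mult B 0) by (simpl; f_equal; ring).
  apply is_lim_seq_scal_l, is_lim_inv_pronic.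
Qed.

(** * Analytic continuation of the alternating Hurwitz zeta function *)

Section Continuation.

Variable x : C.
Hypothesis Hx : 0 < Re x.

Definition zeta_powers (s : C) (k : nat) : C := pow_deriv x s O (INR k).

Lemma zeta_powers_Cpower s k : zeta_powers s k = Cpower (RtoC (INR k) + x) (- s).
Proof.
  unfold zeta_powers, pow_deriv, shifted_pow, Cpower. simpl poch. rewrite Cmult_1_l. simpl INR. f_equal. ring.
Qed.

Lemma alt_zeta_powers s : alt (zeta_powers s) = zetaE_term s x.
Proof.
  apply functional_extensionality. intros m. unfold alt, zetaE_term. now rewrite zeta_powers_Cpower.
Qed.

Lemma Re_ge_Cmod (s : C) : - Cmod s <= Re s.
Proof. generalize (re_le_Cmod s). intros H. apply Rabs_le_between in H. lra. Qed.

Lemma zeta_powers_fdiffn s N : Cmod s + 4 <= INR N ->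
  Ctends (fdiffn N (zeta_powers s)) 0 /\ exists l, Cis_series (alt (fdiffn N (zeta_powers s))) l.
Proof.
  intros HN. destruct (pow_deriv_fdiffn x Hx s N) as [B HB].
  { generalize (Re_ge_Cmod s). lra. }
  split; [exact (Ctends_inv_pronic _ _ HB) | ].
  destruct (ex_series_majorized (alt (fdiffn N (zeta_powers s))) B) as [l [Hl _]].
  - intros m. rewrite Cmod_alt. apply HB.
  - now exists l.
Qed.

(** One more step than [zeta_euler_eq] asks for, so that a single order serves a whole
    neighbourhood of [s] of radius 1. *)
Definition euler_order (s : C) : nat := Z.to_nat (up (Cmod s + 5)).

Lemma euler_order_large s : Cmod s + 5 <= INR (euler_order s).
Proof.
  destruct (archimed (Cmod s + 5)) as [H _]. generalize (Cmod_ge_0 s); intros H0.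
  unfold euler_order. rewrite INR_IZR_INZ, Z2Nat.id; [lra | ].
  apply le_IZR. lra.
Qed.

Definition zeta_euler (s : C) : C := euler (euler_order s) (zeta_powers s).

Lemma euler_zeta_powers_le s N k : Cmod s + 4 <= INR N -> euler (N + k) (zeta_powers s) = euler N (zeta_powers s).
Proof.
  intros HN. induction k as [ | k IH]; [now rewrite Nat.add_0_r | ].
  rewrite Nat.add_succ_r, <- IH.
  destruct (zeta_powers_fdiffn s (N + k)) as [H [l Hl]].
  - rewrite plus_INR. generalize (pos_INR k). lra.
  - now apply (euler_S _ _ l).
Qed.

Lemma zeta_euler_eq s N : Cmod s + 4 <= INR N -> zeta_euler s = euler N (zeta_powers s).
Proof.
  intros HN. unfold zeta_euler. generalize (euler_order_large s); intros Ho.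
  destruct (Nat.le_ge_cases N (euler_order s)) as [H | H].
  - replace (euler_order s) with (N + (euler_order s - N))%nat by lia. now apply euler_zeta_powers_le.
  - replace N with (euler_order s + (N - euler_order s))%nat by lia. symmetry. apply euler_zeta_powers_le. lra.
Qed.

(** Near [s] the continuation is a transformation of fixed order, so the remainder of the sum
    is the transformed sum of the remainders. *)
Lemma zeta_euler_entire : entire zeta_euler.
Proof.
  intros s. set (N := euler_order s).
  assert (HN : Cmod s + 5 <= INR N) by apply euler_order_large.
  assert (Hs : 4 <= Re s + INR N) by (generalize (Re_ge_Cmod s); lra).
  exists (euler N (fun k => pow_deriv_exponent x s O (INR k))).
  destruct (pow_deriv_rem_fdiffn x Hx s N Hs) as [B HB].
  destruct (pow_deriv_rem_bound x Hx s O) as [A [HA HR]].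
  destruct (pow_deriv_exponent_fdiffn x Hx s N Hs) as [B' HB'].
  destruct (euler_bound N
    (fun m => A * exp (2 * ln (1 + INR m)) * Cmod (shifted_pow x s 0 (INR m))) B) as [K HK].
  apply (Cis_derive_quadratic _ _ _ K). intros h Hh.
  assert (Hsh : Cmod (s + h) + 4 <= INR N) by (generalize (Cmod_triangle s h); lra).
  rewrite (zeta_euler_eq (s + h) N) by exact Hsh.
  rewrite (zeta_euler_eq s N) by lra.
  destruct (zeta_powers_fdiffn (s + h) N Hsh) as [_ [l1 Hl1]].
  destruct (zeta_powers_fdiffn s N) as [_ [l2 Hl2]]; [lra | ].
  destruct (ex_series_majorized (alt (fdiffn N (fun k => pow_deriv_exponent x s O (INR k)))) B') as [l3 [Hl3 _]].
  { intros m. rewrite Cmod_alt. apply HB'. }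
  rewrite <- (euler_linear N _ _ _ h l1 l2 l3) by assumption.
  apply HK; [apply Rle_0_sqr | | ].
  - intros m. apply HR; [exact Hh | apply pos_INR].
  - intros m. apply HB, Hh.
Qed.

Lemma zeta_powers_tends_0 s : 0 < Re s -> Ctends (zeta_powers s) 0.
Proof.
  intros Hs. destruct (Clog_bound x Hx) as [K [HK HL]].
  set (c := Re s * K + Rabs (Im s) * K).
  apply (Ctends_squeeze _ (fun k => exp (c - Re s * ln (INR (S k))))).
  - intros k. destruct (HL (INR k) (pos_INR k)) as [H1 [H2 _]].
    rewrite zeta_powers_Cpower. unfold Cpower. rewrite Cmod_Cexp. apply exp_le.
    rewrite S_INR, (Rplus_comm _ 1).
    set (l := Clog (RtoC (INR k) + x)) in *.
    replace (Re (- s * l)%C) with (- Re s * Re l + Im s * Im l) by (unfold Re, Im; simpl; ring).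
    assert (Im s * Im l <= Rabs (Im s) * K).
    { eapply Rle_trans; [apply Rle_abs | ]. rewrite Rabs_mult.
      apply Rmult_le_compat_l; [apply Rabs_pos | exact H2]. }
    apply Rabs_le_between in H1.
    assert (Re s * (ln (1 + INR k) - K) <= Re s * Re l) by (apply Rmult_le_compat_l; lra).
    unfold c. lra.
  - apply (is_lim_comp_seq exp _ m_infty 0); [apply is_lim_exp_m | exists O; discriminate | ].
    apply (is_lim_seq_minus _ _ c p_infty); [apply is_lim_seq_const | | reflexivity].
    replace p_infty with (Rbar_mult (Re s) p_infty).
    + apply is_lim_seq_scal_l. apply (is_lim_comp_seq ln _ p_infty p_infty);
        [apply is_lim_ln_p | exists O; discriminate | ].
      apply (is_lim_seq_incr_1 INR), is_lim_seq_INR.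
    + simpl. destruct (Rle_dec 0 (Re s)) as [H | H]; [ | lra].
      destruct (Rle_lt_or_eq_dec 0 (Re s) H); [reflexivity | lra].
Qed.

Lemma zeta_euler_continuation : zetaE_continuation x zeta_euler.
Proof.
  split; [exact zeta_euler_entire | ]. intros s Hs. rewrite <- alt_zeta_powers.
  destruct (zeta_powers_fdiffn s (euler_order s)) as [_ [l Hl]]; [generalize (euler_order_large s); lra | ].
  apply (euler_series _ _ l); [apply zeta_powers_tends_0, Hs | exact Hl].
Qed.

(** At exponent 0 all terms are 1 and the differences vanish: the sum [1 - 1 + 1 - ...] is
    given its Abel value. *)
Lemma zeta_euler_0 : zeta_euler 0 = (/ 2)%C.
Proof.
  assert (Hz : forall N m, fdiffn N (fun _ => RtoC 0) m = RtoC 0).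
  { induction N as [ | N IH]; intros m; [reflexivity | ].
    rewrite fdiffn_S. unfold fdiff. rewrite !IH. ring. }
  assert (He : forall N, euler N (fun _ => RtoC 0) = RtoC 0).
  { intros N. destruct (euler_bound N (fun _ => 0) 0) as [K HK].
    apply Cmod_eq_0. apply Rle_antisym; [ | apply Cmod_ge_0].
    apply Rle_trans with (K * 0); [ | lra]. apply HK; [lra | | ]; intros m; cbv beta; rewrite ?Hz, Cmod_0; lra. }
  rewrite (zeta_euler_eq 0 5) by (rewrite Cmod_0; simpl; lra).
  change (euler 5 (zeta_powers 0)) with ((zeta_powers 0 O + euler 4 (fdiff (zeta_powers 0))) / 2)%C.
  assert (H1 : forall k, zeta_powers 0 k = RtoC 1).
  { intros k. rewrite zeta_powers_Cpower. unfold Cpower. rewrite <- Cexp_0. f_equal. ring. }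
  replace (fdiff (zeta_powers 0)) with (fun _ : nat => RtoC 0).
  - rewrite He, H1. field.
  - apply functional_extensionality. intros k. unfold fdiff. rewrite !H1. ring.
Qed.

Lemma zetaE_spec : zetaE_continuation x (fun s => zetaE s x).
Proof.
  unfold zetaE. apply epsilon_spec. exists zeta_euler. exact zeta_euler_continuation.
Qed.

End Continuation.

(** * Values and derivatives at the origin *)

(** The complex numbers as a module over themselves and as a plane have the same norm, hence
    the same derivatives; only in the first guise can functions be multiplied. *)
Lemma Cis_derive_AbsRing (f : C -> C) (s l : C) :
  @is_derive C_AbsRing (AbsRing_NormedModule C_AbsRing) f s l <-> Cis_derive f s l.
Proof. split; intros [_ H]; (split; [apply is_linear_scal_l | exact H]). Qed.

Lemma Cis_derive_mult (f g : C -> C) (s a b : C) :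
  Cis_derive f s a -> Cis_derive g s b ->
  Cis_derive (fun s => (f s * g s)%C) s (a * g s + f s * b)%C.
Proof.
  intros Hf Hg. apply Cis_derive_AbsRing.
  apply (@is_derive_mult C_AbsRing f g s a b);
    [apply Cis_derive_AbsRing, Hf | apply Cis_derive_AbsRing, Hg | exact Cmult_comm].
Qed.

Lemma Cis_derive_scal (c : C) (f : C -> C) (s a : C) :
  Cis_derive f s a -> Cis_derive (fun s => (c * f s)%C) s (c * a)%C.
Proof.
  intros Hf. replace (c * a)%C with (0 * f s + c * a)%C by ring.
  apply (Cis_derive_mult (fun _ => c) f); [ | exact Hf].
  exact (@is_derive_const C_AbsRing C_NormedModule c s).
Qed.

Lemma Cis_derive_Cexp_scal (a : C) : Cis_derive (fun s => Cexp (s * a)) (RtoC 0) a.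
Proof.
  apply (Cis_derive_quadratic _ _ _ (4 * (Cmod a)² * exp (Cmod a))). intros h Hh.
  rewrite Cplus_0_l, Cmult_0_l, Cexp_0.
  eapply Rle_trans; [apply Cexp_remainder | ]. rewrite Cmod_mult, Rsqr_mult.
  generalize (Cmod_ge_0 h), (Cmod_ge_0 a); intros H0 Ha.
  assert (exp (Cmod h * Cmod a) <= exp (Cmod a)) by (apply exp_le; nra).
  replace (4 * (Cmod a)² * exp (Cmod a) * (Cmod h)²)
    with (4 * ((Cmod h)² * (Cmod a)²) * exp (Cmod a)) by ring.
  apply Rmult_le_compat_l; [ | assumption].
  generalize (Rle_0_sqr (Cmod h)), (Rle_0_sqr (Cmod a)). nra.
Qed.

Lemma Cmod_small_eq_0 (z : C) : (forall eps, 0 < eps -> Cmod z <= eps) -> z = 0%C.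
Proof.
  intros H. apply Cmod_eq_0, Rle_antisym; [ | apply Cmod_ge_0].
  apply le_epsilon. intros eps He. rewrite Rplus_0_l. apply H, He.
Qed.

(** A complex derivative is a limit along every direction, in particular along the positive
    real axis. *)
Lemma derive_vanish_right (f : C -> C) (l : C) :
  Cis_derive f (RtoC 0) l -> (forall t : R, 0 < t -> f (RtoC t) = 0%C) -> f 0 = 0%C /\ l = 0%C.
Proof.
  rewrite Cis_derive_eps. intros Hd Hf.
  assert (H0 : f 0 = 0%C).
  { destruct (Hd 1 Rlt_0_1) as [d [Hd0 H]]. apply Cmod_small_eq_0. intros eps He.
    set (c := 1 + Cmod l). assert (Hc : 1 <= c) by (generalize (Cmod_ge_0 l); unfold c; lra).
    set (t := Rmin (d / 2) (eps / c)).
    assert (Ht : 0 < t) by (apply Rmin_pos; [lra | apply Rdiv_lt_0_compat; lra]).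
    assert (Htd : t <= d / 2) by apply Rmin_l. assert (Hte : t <= eps / c) by apply Rmin_r.
    assert (Hct : c * t <= eps).
    { apply Rle_trans with (c * (eps / c)); [apply Rmult_le_compat_l; lra | right; field; lra]. }
    assert (Hm : Cmod (RtoC t) = t) by (rewrite Cmod_R; apply Rabs_pos_eq; lra).
    specialize (H (RtoC t)). rewrite Hm, Cplus_0_l, Hf in H by exact Ht.
    specialize (H ltac:(lra)).
    assert (T := Cmod_triangle (0 - f 0 - RtoC t * l) (RtoC t * l)).
    replace (0 - f 0 - RtoC t * l + RtoC t * l)%C with (- f 0)%C in T by ring.
    rewrite Cmod_opp, Cmod_mult, Hm in T. unfold c in Hct. lra. }
  split; [exact H0 | ]. apply Cmod_small_eq_0. intros eps He.
  destruct (Hd eps He) as [d [Hd0 H]].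
  assert (Hm : Cmod (RtoC (d / 2)) = d / 2) by (rewrite Cmod_R; apply Rabs_pos_eq; lra).
  specialize (H (RtoC (d / 2))). rewrite Hm, Cplus_0_l, Hf, H0 in H by lra.
  specialize (H ltac:(lra)).
  replace (0 - 0 - RtoC (d / 2) * l)%C with (- (RtoC (d / 2) * l))%C in H by ring.
  rewrite Cmod_opp, Cmod_mult, Hm in H. nra.
Qed.

Lemma derive_eq_right (f g : C -> C) (a b : C) :
  Cis_derive f (RtoC 0) a -> Cis_derive g (RtoC 0) b ->
  (forall t : R, 0 < t -> f (RtoC t) = g (RtoC t)) -> f 0 = g 0 /\ a = b.
Proof.
  intros Hf Hg H.
  destruct (derive_vanish_right (fun s => (f s - g s)%C) (a - b)%C) as [H1 H2].
  - exact (@is_derive_minus C_AbsRing C_NormedModule f g (RtoC 0) a b Hf Hg).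
  - intros t Ht. rewrite H by exact Ht. ring.
  - split.
    + replace (f 0) with (f 0 - g 0 + g 0)%C by ring. rewrite H1. ring.
    + replace a with (a - b + b)%C by ring. rewrite H2. ring.
Qed.

Lemma zetaE_derive (x : C) : 0 < Re x ->
  Cis_derive (fun s => zetaE s x) (RtoC 0) (C_derive (fun s => zetaE s x) 0).
Proof.
  intros Hx. apply C_derive_correct; [exact (RtoC 0) | ]. apply (zetaE_spec x Hx).
Qed.

Lemma zetaE_0 (x : C) : 0 < Re x -> zetaE 0 x = (/ 2)%C.
Proof.
  intros Hx. rewrite <- (zeta_euler_0 x Hx).
  destruct (zeta_euler_entire x Hx 0%C) as [l Hl].
  apply (derive_eq_right (fun s => zetaE s x) (zeta_euler x) _ l (zetaE_derive x Hx) Hl).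
  intros t Ht.
  destruct (zetaE_spec x Hx) as [_ H1]. destruct (zeta_euler_continuation x Hx) as [_ H2].
  specialize (H1 (RtoC t) Ht). specialize (H2 (RtoC t) Ht).
  rewrite is_series_Ctends in H1, H2. exact (Ctends_unique _ _ _ H1 H2).
Qed.

(** * Finite sums *)

Fixpoint Cfinsum (f : nat -> C) (n : nat) : C :=
  match n with O => 0 | S n => (Cfinsum f n + f n)%C end.

Lemma sum_n_Cfinsum (f : nat -> C) n : sum_n f n = Cfinsum f (S n).
Proof.
  induction n as [ | n IH].
  - rewrite sum_O. simpl. ring.
  - rewrite sum_Sn, IH. reflexivity.
Qed.

Lemma Cfinsum_ext f g n : (forall k, (k < n)%nat -> f k = g k) -> Cfinsum f n = Cfinsum g n.
Proof.
  induction n as [ | n IH]; intros H; [reflexivity | ].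
  simpl. rewrite H by lia. rewrite IH; [reflexivity | intros; apply H; lia].
Qed.

Lemma Cfinsum_plus f g n : Cfinsum (fun k => (f k + g k)%C) n = (Cfinsum f n + Cfinsum g n)%C.
Proof. induction n as [ | n IH]; simpl; [ring | rewrite IH; ring]. Qed.

Lemma Cfinsum_scal c f n : Cfinsum (fun k => (c * f k)%C) n = (c * Cfinsum f n)%C.
Proof. induction n as [ | n IH]; simpl; [ring | rewrite IH; ring]. Qed.

Lemma Cfinsum_swap (f : nat -> nat -> C) m n :
  Cfinsum (fun i => Cfinsum (f i) n) m = Cfinsum (fun j => Cfinsum (fun i => f i j) m) n.
Proof.
  induction m as [ | m IH]; simpl.
  - induction n as [ | n IH]; simpl; [reflexivity | rewrite <- IH; ring].
  - rewrite IH, <- Cfinsum_plus. reflexivity.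
Qed.

Lemma Cfinsum_add f m n : Cfinsum f (m + n) = (Cfinsum f m + Cfinsum (fun k => f (m + k)%nat) n)%C.
Proof.
  induction n as [ | n IH]; simpl.
  - rewrite Nat.add_0_r. ring.
  - rewrite Nat.add_succ_r. simpl. rewrite IH. ring.
Qed.

Lemma Cfinsum_blocks f b q :
  Cfinsum f (b * q) = Cfinsum (fun i => Cfinsum (fun r => f (b * i + r)%nat) b) q.
Proof.
  induction q as [ | q IH].
  - now rewrite Nat.mul_0_r.
  - rewrite Nat.mul_succ_r, Cfinsum_add, IH. reflexivity.
Qed.

Lemma Cfinsum_tends (u : nat -> nat -> C) (l : nat -> C) n :
  (forall i, (i < n)%nat -> Ctends (u i) (l i)) ->
  Ctends (fun k => Cfinsum (fun i => u i k) n) (Cfinsum l n).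
Proof.
  induction n as [ | n IH]; intros H; simpl; [apply Ctends_const | ].
  apply Ctends_plus; [apply IH; intros; apply H; lia | apply H; lia].
Qed.

Lemma Cis_derive_Cfinsum (f : nat -> C -> C) (l : nat -> C) s n :
  (forall i, (i < n)%nat -> Cis_derive (f i) s (l i)) ->
  Cis_derive (fun s => Cfinsum (fun i => f i s) n) s (Cfinsum l n).
Proof.
  induction n as [ | n IH]; intros H; simpl.
  - exact (@is_derive_const C_AbsRing C_NormedModule (RtoC 0) s).
  - apply (@is_derive_plus C_AbsRing C_NormedModule (fun s => Cfinsum (fun i => f i s) n) (f n));
      [apply IH; intros; apply H; lia | apply H; lia].
Qed.

Lemma m1_pow_add m n : ((- (1)) ^ (m + n))%C = ((- (1)) ^ m * (- (1)) ^ n)%C.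
Proof. induction m as [ | m IH]; simpl; [ring | rewrite IH; ring]. Qed.

Lemma m1_pow_even n : ((- (1)) ^ (2 * n))%C = 1%C.
Proof.
  replace (2 * n)%nat with (n + n)%nat by lia. rewrite m1_pow_add.
  induction n as [ | n IH]; simpl; [ring | ].
  transitivity ((- (1)) ^ n * (- (1)) ^ n)%C; [ring | exact IH].
Qed.

Lemma m1_pow_odd_mul N q : Nat.Odd N -> ((- (1)) ^ (N * q))%C = ((- (1)) ^ q)%C.
Proof.
  intros [k ->]. replace ((2 * k + 1) * q)%nat with (2 * (k * q) + q)%nat by lia.
  rewrite m1_pow_add, m1_pow_even. ring.
Qed.

Lemma Cfinsum_m1_pow N : Nat.Odd N -> Cfinsum (fun m => ((- (1)) ^ m)%C) N = 1%C.
Proof.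
  intros [k ->]. induction k as [ | k IH]; [simpl; ring | ].
  replace (2 * S k + 1)%nat with (S (S (2 * k + 1))) by lia. cbn [Cfinsum]. rewrite IH.
  simpl Cpow. ring.
Qed.

(** A partial sum of the zeta values at the nodes, after clearing denominators. The inner
    range is a multiple of [N] so that it splits into complete blocks. *)
Definition lattice_sum (F : nat -> C) (M N Q : nat) : C :=
  Cfinsum (fun m => ((- (1)) ^ m * Cfinsum (fun k => ((- (1)) ^ k * F (M * k + N * m)%nat)%C) (N * Q))%C) M.

(** With [k = N q + r], oddness of [N] turns [(-1)^(N q)] into [(-1)^q], and the argument of
    [F] becomes symmetric in the pairs [(M, r)] and [(N, m)]. *)
Lemma lattice_sum_blocks F M N Q : Nat.Odd N ->
  lattice_sum F M N Q
  = Cfinsum (fun q => Cfinsum (fun m => Cfinsum (fun r =>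
      ((- (1)) ^ (q + (m + r)) * F (M * N * q + (M * r + N * m))%nat)%C) N) M) Q.
Proof.
  intros HN. rewrite Cfinsum_swap. apply Cfinsum_ext. intros m _.
  rewrite Cfinsum_blocks, <- Cfinsum_scal. apply Cfinsum_ext. intros q _.
  rewrite <- Cfinsum_scal. apply Cfinsum_ext. intros r _.
  rewrite !m1_pow_add, m1_pow_odd_mul by exact HN.
  replace (M * (N * q + r) + N * m)%nat with (M * N * q + (M * r + N * m))%nat by ring. ring.
Qed.

Lemma lattice_sum_sym F M N Q : Nat.Odd M -> Nat.Odd N ->
  lattice_sum F M N Q = lattice_sum F N M Q.
Proof.
  intros HM HN. rewrite !lattice_sum_blocks by assumption.
  apply Cfinsum_ext. intros q _. rewrite Cfinsum_swap.
  apply Cfinsum_ext. intros r _. apply Cfinsum_ext. intros m _.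
  replace (q + (m + r))%nat with (q + (r + m))%nat by lia.
  replace (M * N * q + (M * r + N * m))%nat with (N * M * q + (N * m + M * r))%nat by ring.
  reflexivity.
Qed.

(** * The distribution relation *)

Definition node (M N : nat) (x : C) (m : nat) : C :=
  (RtoC (INR N) * x + RtoC (INR N) / RtoC (INR M) * RtoC (INR m))%C.

Lemma node_pos M N x m : (0 < M)%nat -> (0 < N)%nat -> 0 < Re x -> 0 < Re (node M N x m).
Proof.
  intros HM HN Hx. apply lt_0_INR in HM. apply lt_0_INR in HN.
  unfold node. rewrite <- RtoC_div, <- RtoC_mult by lra.
  replace (Re _) with (INR N * Re x + INR N / INR M * INR m)
    by (unfold Re, Im; simpl; ring).
  assert (0 < INR N * Re x) by (apply Rmult_lt_0_compat; assumption).
  assert (0 <= INR N / INR M * INR m)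
    by (apply Rmult_le_pos; [left; apply Rdiv_lt_0_compat; assumption | apply pos_INR]).
  lra.
Qed.

Definition zeta_node_sum (M N : nat) (x s : C) : C :=
  Cfinsum (fun m => ((- (1)) ^ m * zetaE s (node M N x m))%C) M.

Lemma node_power M N x s m k : (0 < M)%nat -> (0 < N)%nat -> 0 < Re x ->
  zeta_powers (node M N x m) s k
  = (Cexp (s * RtoC (ln (INR M)))
     * Cpower (RtoC (INR (M * k + N * m)) + RtoC (INR (M * N)) * x) (- s))%C.
Proof.
  intros HM HN Hx. rewrite zeta_powers_Cpower. unfold Cpower. rewrite <- Cexp_plus. f_equal.
  apply lt_0_INR in HM. apply lt_0_INR in HN.
  set (u := (RtoC (INR (M * k + N * m)) + RtoC (INR (M * N)) * x)%C).
  assert (Hu : 0 < Re u).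
  { unfold u. replace (Re _) with (INR (M * k + N * m) + INR (M * N) * Re x)
      by (unfold Re, Im; simpl; ring).
    generalize (pos_INR (M * k + N * m)). rewrite mult_INR.
    assert (0 < INR M * INR N * Re x) by (repeat apply Rmult_lt_0_compat; assumption). lra. }
  replace (RtoC (INR k) + node M N x m)%C with (RtoC (/ INR M) * u)%C.
  - rewrite Clog_scal by (try apply Rinv_0_lt_compat; assumption).
    rewrite ln_Rinv, RtoC_opp by exact HM. ring.
  - unfold u, node. rewrite plus_INR, !mult_INR, RtoC_plus, !RtoC_mult, RtoC_inv by lra.
    field. intros E. apply RtoC_inj in E. lra.
Qed.

(** The series converge only conditionally for small [Re s], so they are not rearranged:
    partial sums are taken along complete blocks, where the symmetry is an identity of finite
    sums. *)
Lemma zeta_node_sum_tends M N x s :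
  (0 < M)%nat -> (0 < N)%nat -> 0 < Re x -> 0 < Re s ->
  Ctends (fun Q => lattice_sum
           (fun n => Cpower (RtoC (INR n) + RtoC (INR (M * N)) * x) (- s)) M N (S Q))
         (Cexp (s * RtoC (- ln (INR M))) * zeta_node_sum M N x s)%C.
Proof.
  intros HM HN Hx Hs. unfold lattice_sum, zeta_node_sum.
  rewrite <- Cfinsum_scal. apply Cfinsum_tends. intros m _.
  set (y := node M N x m). assert (Hy : 0 < Re y) by (apply node_pos; assumption).
  destruct (zetaE_spec y Hy) as [_ H]. specialize (H s Hs).
  rewrite <- alt_zeta_powers, is_series_Ctends in H.
  apply (Ctends_subseq _ _ (fun Q => N * S Q - 1)%nat) in H.
  2: { intros Q. nia. }
  apply (Ctends_scal (Cexp (s * RtoC (- ln (INR M))) * (- (1)) ^ m)%C) in H.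
  rewrite Cmult_assoc.
  revert H. apply Ctends_ext. intros Q.
  rewrite sum_n_Cfinsum. replace (S (N * S Q - 1)) with (N * S Q)%nat by nia.
  rewrite <- Cfinsum_scal, <- Cfinsum_scal. apply Cfinsum_ext. intros k _.
  unfold alt. unfold y. rewrite node_power by assumption.
  rewrite RtoC_opp.
  replace (s * - RtoC (ln (INR M)))%C with (- (s * RtoC (ln (INR M))))%C by ring.
  rewrite Cexp_opp. field. apply Cexp_neq_0.
Qed.

Lemma zeta_node_sum_sym M N x s :
  Nat.Odd M -> Nat.Odd N -> (0 < M)%nat -> (0 < N)%nat -> 0 < Re x -> 0 < Re s ->
  (Cexp (s * RtoC (- ln (INR M))) * zeta_node_sum M N x s)%C
  = (Cexp (s * RtoC (- ln (INR N))) * zeta_node_sum N M x s)%C.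
Proof.
  intros OM ON HM HN Hx Hs.
  apply (Ctends_unique _ _ _ (zeta_node_sum_tends M N x s HM HN Hx Hs)).
  generalize (zeta_node_sum_tends N M x s HN HM Hx Hs). apply Ctends_ext. intros Q.
  rewrite (Nat.mul_comm N M). now apply lattice_sum_sym.
Qed.

Definition log_gamma_sum (M N : nat) (x : C) : C :=
  Cfinsum (fun m => ((- (1)) ^ m * C_derive (fun s => zetaE s (node M N x m)) 0)%C) M.

Lemma zeta_node_sum_0 M N x : Nat.Odd M -> (0 < M)%nat -> (0 < N)%nat -> 0 < Re x ->
  zeta_node_sum M N x 0 = (/ 2)%C.
Proof.
  intros OM HM HN Hx. unfold zeta_node_sum.
  rewrite (Cfinsum_ext _ (fun m => (/ 2 * (- (1)) ^ m)%C)).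
  - rewrite Cfinsum_scal, Cfinsum_m1_pow by exact OM. ring.
  - intros m _. rewrite zetaE_0 by (apply node_pos; assumption). ring.
Qed.

(** The product rule: the logarithmic term is weighted by the value 1/2 at the origin. *)
Lemma twisted_derive M N x : Nat.Odd M -> (0 < M)%nat -> (0 < N)%nat -> 0 < Re x ->
  Cis_derive (fun s => (Cexp (s * RtoC (- ln (INR M))) * zeta_node_sum M N x s)%C) (RtoC 0)
    (RtoC (- ln (INR M) / 2) + log_gamma_sum M N x)%C.
Proof.
  intros OM HM HN Hx.
  replace (RtoC (- ln (INR M) / 2) + log_gamma_sum M N x)%C
    with (RtoC (- ln (INR M)) * zeta_node_sum M N x 0
          + Cexp (0 * RtoC (- ln (INR M))) * log_gamma_sum M N x)%C.
  - apply (Cis_derive_mult (fun s => Cexp (s * RtoC (- ln (INR M)))) (zeta_node_sum M N x));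
      [apply Cis_derive_Cexp_scal | ].
    apply (Cis_derive_Cfinsum (fun m s => ((- (1)) ^ m * zetaE s (node M N x m))%C)). intros m _.
    apply Cis_derive_scal, zetaE_derive, node_pos; assumption.
  - rewrite zeta_node_sum_0 by assumption. rewrite Cmult_0_l, Cexp_0.
    rewrite RtoC_div by lra. field.
Qed.

Lemma log_gamma_sum_sym M N x :
  Nat.Odd M -> Nat.Odd N -> (0 < M)%nat -> (0 < N)%nat -> 0 < Re x ->
  (RtoC (- ln (INR M) / 2) + log_gamma_sum M N x)%C
  = (RtoC (- ln (INR N) / 2) + log_gamma_sum N M x)%C.
Proof.
  intros OM ON HM HN Hx.
  apply (derive_eq_right _ _ _ _ (twisted_derive M N x OM HM HN Hx)
                               (twisted_derive N M x ON HN HM Hx)).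
  intros t Ht. now apply zeta_node_sum_sym.
Qed.

(** * From logarithms to products *)

Lemma CpowZ_m1_pow (z : C) (m : nat) :
  CpowZ (Cexp z) ((-1) ^ Z.of_nat m)%Z = Cexp ((- (1)) ^ m * z).
Proof.
  assert (H : ((-1) ^ Z.of_nat m)%Z = 1%Z /\ ((- (1)) ^ m)%C = 1%C \/
              ((-1) ^ Z.of_nat m)%Z = (-1)%Z /\ ((- (1)) ^ m)%C = (- (1))%C).
  { induction m as [ | m IH]; [left; split; reflexivity | ].
    rewrite Nat2Z.inj_succ, Z.pow_succ_r by apply Nat2Z.is_nonneg.
    destruct IH as [[E1 E2] | [E1 E2]]; rewrite E1; simpl Cpow; rewrite E2;
      [right | left]; split; try reflexivity; ring. }
  destruct H as [[E1 E2] | [E1 E2]]; rewrite E1, E2; simpl CpowZ;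
    change (Pos.to_nat 1) with 1%nat; simpl Cpow.
  - rewrite Cmult_1_l. ring.
  - rewrite Cmult_1_r, <- Cexp_opp. f_equal. ring.
Qed.

Lemma Cprod_Cexp (f : nat -> C) (g : nat -> C) n :
  (forall m, f m = Cexp (g m)) -> Cprod f n = Cexp (Cfinsum g n).
Proof.
  intros H. induction n as [ | n IH]; simpl.
  - now rewrite Cexp_0.
  - now rewrite IH, H, Cexp_plus.
Qed.

Lemma gamma_product M N x :
  Cprod (fun m => CpowZ (Gamma1_bar (node M N x m)) ((-1) ^ Z.of_nat m)%Z) M
  = Cexp (log_gamma_sum M N x).
Proof. apply Cprod_Cexp. intros m. apply CpowZ_m1_pow. Qed.

Lemma RtoC_sqrt_exp (N : nat) : (0 < N)%nat ->
  RtoC (sqrt (INR N)) = Cexp (RtoC (ln (INR N) / 2)).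
Proof.
  intros HN. apply lt_0_INR in HN. rewrite Cexp_RtoC, <- Rpower_sqrt by exact HN.
  unfold Rpower. do 2 f_equal. field.
Qed.

Theorem theorem3p12 (N1 N2 : nat)
  (hN1pos : (0 < N1)%nat) (hN1odd : Nat.Odd N1)
  (hN2pos : (0 < N2)%nat) (hN2odd : Nat.Odd N2)
  (x : C) (hx : 0 < Re x) :
  (RtoC (sqrt (INR N2)) *
     Cprod (fun m1 : nat =>
       CpowZ (Gamma1_bar (RtoC (INR N2) * x
                          + RtoC (INR N2) / RtoC (INR N1) * RtoC (INR m1)))
             ((-1) ^ Z.of_nat m1)%Z) N1)%C
  =
  (RtoC (sqrt (INR N1)) *
     Cprod (fun m2 : nat =>
       CpowZ (Gamma1_bar (RtoC (INR N1) * x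
                          + RtoC (INR N1) / RtoC (INR N2) * RtoC (INR m2)))
             ((-1) ^ Z.of_nat m2)%Z) N2)%C.
Proof.
  change ((RtoC (sqrt (INR N2)) *
     Cprod (fun m => CpowZ (Gamma1_bar (node N1 N2 x m)) ((-1) ^ Z.of_nat m)%Z) N1)%C
    = (RtoC (sqrt (INR N1)) *
     Cprod (fun m => CpowZ (Gamma1_bar (node N2 N1 x m)) ((-1) ^ Z.of_nat m)%Z) N2)%C).
  rewrite !gamma_product, !RtoC_sqrt_exp, <- !Cexp_plus by assumption. f_equal.
  generalize (log_gamma_sum_sym N1 N2 x hN1odd hN2odd hN1pos hN2pos hx).
  unfold Rdiv. rewrite !Ropp_mult_distr_l_reverse, !RtoC_opp. intros E.
  replace (log_gamma_sum N1 N2 x)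
    with (- - RtoC (ln (INR N1) * / 2) + (- RtoC (ln (INR N1) * / 2) + log_gamma_sum N1 N2 x))%C by ring.
  rewrite E. ring.
Qed.
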